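(* Let $\rho\in(0,\pi/2)$. The circular cone $C_\rho$ of half-angle $\rho$ is an admissible medium cone.
   Context: **Circular cone.** $C_\rho$ is the closed cone with vertex at the origin consisting of the points with spherical coordinates $(r,\vartheta,\varphi)$, $r\ge0$, $0\le\vartheta\le\rho$, $0\le\varphi<2\pi$, where $x=(r\sin\vartheta\cos\varphi,r\sin\vartheta\sin\varphi,r\cos\vartheta)$. **Admissible medium cone.** A closed cone $C\subset\mathbb R^3$ such that: (i) $C$ is contained in a strictly convex closed circular cone (half-opening angle $<\pi/2$); (ii) $C$ has a connected exterior; (iii) in suitable orthonormal coordinates $C=\{(tx',t):x'\in D,\ t\ge0\}$ with a bounded cross-section $D\subset\mathbb R^2$ such that $\chi_D\in H^\tau(\mathbb R^2)$ ($L^2$-based Sobolev space) for some $\tau\in(1/4,1/2)$; (iv) for any spherical harmonic $H\not\equiv0$ of arbitrary degree $N\ge0$ there is $m\in\{-N-2,\dots,N+2\}$ with $\int_{C\cap\mathbb S^2}Y_{N+2}^mH\,dS\ne0$. **Spherical harmonics.** $Y_N^m(\varphi,\vartheta)=(-1)^m\sqrt{\tfrac{2N+1}{4\pi}\tfrac{(N-m)!}{(N+m)!}}\,e^{im\varphi}P_N^m(\cos\vartheta)$, where, with $P_N$ the Legendre polynomials, $P_N^m(x)=(-1)^m(1-x^2)^{m/2}\partial_x^mP_N(x)$ and $P_N^{-m}=(-1)^m\frac{(N-m)!}{(N+m)!}P_N^m$ for $m=0,\dots,N$. *)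

(* Defs.v *)
From HB Require Import structures.
From mathcomp Require Import all_boot all_order all_algebra.
From mathcomp Require Import all_classical all_reals all_analysis.
From mathcomp Require Import complex.

Set Implicit Arguments.
Unset Strict Implicit.
Unset Printing Implicit Defensive.

Import Order.TTheory GRing.Theory Num.Theory.
Import numFieldNormedType.Exports.

Local Open Scope classical_set_scope.
Local Open Scope complex_scope.
Local Open Scope ring_scope.

Definition cexpi (R : realType) (t : R) : R[i] := cos t +i* sin t.

Definition cintegral (d : measure_display) (T : measurableType d) (R : realType)
    (mu : {measure set T -> \bar R}) (A : set T) (F : T -> R[i]) : R[i] :=
  (\int[mu]_(x in A) complex.Re (F x)) +i* (\int[mu]_(x in A) complex.Im (F x)).

Definition cL2 (d : measure_display) (T : measurableType d) (R : realType)
    (mu : {measure set T -> \bar R}) (F : T -> R[i]) : Prop :=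
  (fun x => complex.Re (F x)) \in Lfun mu 2%:E /\
  (fun x => complex.Im (F x)) \in Lfun mu 2%:E.

Section Sobolev.
Variable R : realType.

Definition lebesgue2 :
    {measure set (measurableTypeR R * measurableTypeR R)%type -> \bar R} :=
  (@lebesgue_measure R \x @lebesgue_measure R)%E.

Definition dot2 (x y : R * R) : R := x.1 * y.1 + x.2 * y.2.

Definition truncated_fourier (f : R * R -> R[i]) (n : nat) (xi : R * R) : R[i] :=
  cintegral lebesgue2 [set x | dot2 x x <= n%:R ^+ 2]
    (fun x => f x * cexpi (- dot2 x xi)).

(* g is the Fourier-Plancherel transform of f, with kernel exp(-i x.xi). For f in
   L^2 the truncated integrals need not converge pointwise, so the limit is
   taken in L^2. *)
Definition fourier_transform (f g : R * R -> R[i]) : Prop :=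
  cL2 lebesgue2 g /\
  (\int[lebesgue2]_xi (ComplexField.Normc.normc (truncated_fourier f n xi - g xi) ^+ 2)%:E)%E
    @[n --> \oo] --> 0%E.

(* H^s(R^2) for s >= 0. *)
Definition sobolev (s : R) (f : R * R -> R[i]) : Prop :=
  cL2 lebesgue2 f /\
  exists2 g : R * R -> R[i], fourier_transform f g &
    cL2 lebesgue2 (fun xi => ((1 + dot2 xi xi) `^ (s / 2))%:C * g xi).

End Sobolev.

Arguments lebesgue2 : clear implicits.

Section SphericalCoordinates.
Variable R : realType.

Definition vec3 (a b c : R) : 'rV[R]_3 := \row_(i < 3) [:: a; b; c]`_i.

Definition spherical_point (r theta phi : R) : 'rV[R]_3 :=
  vec3 (r * sin theta * cos phi) (r * sin theta * sin phi) (r * cos theta).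

(* Pairs (phi, theta), in the order in which the spherical harmonics take
   their arguments. *)
Definition sphere_angles : set (R * R) :=
  [set p | 0 <= p.1 < 2 * pi /\ 0 <= p.2 <= pi].

(* Integral over A `&` S^2 of a function given in angles, dS being
   sin theta dphi dtheta. *)
Definition sphere_integral (A : set 'rV[R]_3) (F : R * R -> R[i]) : R[i] :=
  cintegral (lebesgue2 R)
    [set p | sphere_angles p /\ A (spherical_point 1 p.2 p.1)]
    (fun p => F p * (sin p.2)%:C).

End SphericalCoordinates.

Section SphericalHarmonics.
Variable R : realType.

(* Rodrigues' formula. *)
Definition legendre (N : nat) : {poly R} :=
  (2 ^+ N * N`!%:R)^-1 *: (('X^2 - 1) ^+ N)^`(N).

Definition assoc_legendre_nat (N m : nat) (x : R) : R :=
  (-1) ^+ m * Num.sqrt (1 - x ^+ 2) ^+ m * ((legendre N)^`(m)).[x].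

(* Meaningful for `|m| <= N. *)
Definition assoc_legendre (N : nat) (m : int) (x : R) : R :=
  match m with
  | Posz k => assoc_legendre_nat N k x
  | Negz k => (-1) ^+ k.+1 * ((N - k.+1)`!%:R / (N + k.+1)`!%:R)
              * assoc_legendre_nat N k.+1 x
  end.

(* Meaningful for `|m| <= N, in which case absz only converts N - m and N + m
   to nat. *)
Definition Ylm (N : nat) (m : int) (p : R * R) : R[i] :=
  ((-1) ^+ absz m
   * Num.sqrt ((2 * N + 1)%:R / (4 * pi)
               * ((absz (N%:Z - m))`!%:R / (absz (N%:Z + m))`!%:R)))%:C
  * cexpi (m%:~R * p.1)
  * (assoc_legendre N m (cos p.2))%:C.

(* The index k encodes the order m = k - N, which runs through -N, ..., N. *)
Definition spherical_harmonic (N : nat) (H : R * R -> R[i]) : Prop :=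
  exists c : 'I_(2 * N).+1 -> R[i], forall p, sphere_angles p ->
    H p = \sum_(k < (2 * N).+1) c k * Ylm N (k%:Z - N%:Z) p.

End SphericalHarmonics.

Section Cones.
Variable R : realType.

Definition circular_cone (rho : R) : set 'rV[R]_3 :=
  [set x | exists r theta phi, [/\ 0 <= r, 0 <= theta <= rho,
     0 <= phi < 2 * pi & x = spherical_point r theta phi]].

Definition closed_cone (C : set 'rV[R]_3) : Prop :=
  [/\ closed C, C 0 & forall (t : R) x, 0 <= t -> C x -> C (t *: x)].

(* The rows of Q form an orthonormal basis of R^3; y *m Q is the vector with
   coordinates y in this basis. *)
Definition orthonormal_rows (Q : 'M[R]_3) : Prop := Q *m Q^T = 1%:M.

Definition in_strictly_convex_circular_cone (C : set 'rV[R]_3) : Prop :=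
  exists (alpha : R) (Q : 'M[R]_3), [/\ 0 < alpha < pi / 2, orthonormal_rows Q &
    C `<=` [set y *m Q | y in circular_cone alpha]].

Definition cone_over (D : set (R * R)) : set 'rV[R]_3 :=
  [set y | exists x t, [/\ D x, 0 <= t & y = vec3 (t * x.1) (t * x.2) t]].

Definition has_sobolev_cross_section (C : set 'rV[R]_3) : Prop :=
  exists (Q : 'M[R]_3) (D : set (R * R)),
    [/\ orthonormal_rows Q, C = [set y *m Q | y in cone_over D], bounded_set D &
      exists2 tau : R, 1 / 4 < tau < 1 / 2 &
        sobolev tau (fun x => (\1_D x : R)%:C)].

Definition detects_spherical_harmonics (C : set 'rV[R]_3) : Prop :=
  forall (N : nat) (H : R * R -> R[i]), spherical_harmonic N H ->
    (exists2 p, sphere_angles p & H p != 0) ->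
    exists2 m : int, (- N.+2%:Z <= m <= N.+2%:Z)%R &
      sphere_integral C (fun p => Ylm N.+2 m p * H p) != 0.

Definition admissible_medium_cone (C : set 'rV[R]_3) : Prop :=
  closed_cone C /\
  [/\ in_strictly_convex_circular_cone C,
      connected (~` C),
      has_sobolev_cross_section C &
      detects_spherical_harmonics C].

End Cones.

(* Main.v *)
From HB Require Import structures.
Require Import Defs.
From mathcomp Require Import all_boot all_order all_algebra.
From mathcomp Require Import all_classical all_reals all_analysis.
From mathcomp Require Import measurable_realfun complex ring lra zify.

Set Implicit Arguments.
Unset Strict Implicit.
Unset Printing Implicit Defensive.

Import Order.TTheory GRing.Theory Num.Theory.
Import numFieldNormedType.Exports.

Local Open Scope classical_set_scope.
Local Open Scope ring_scope.

(** The cone is the solution set of 0 <= x_3 and x_1^2 + x_2^2 <= (tan rho x_3)^2,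
    which gives closedness, the inclusion in itself as a strictly convex
    circular cone, the cross-section (the disc of radius tan rho) and an
    exterior that is star-shaped about the point (0, 0, -1). Two properties
    need an argument.

    Spherical harmonics. Let c_k be a nonzero coefficient of H in the basis
    Y_N^k. Against Y_(N+2)^(-k) the integral over the azimuth kills every other
    coefficient (circular_cone_detects), and what remains is a nonzero multiple
    of the integral of P_N^m P_(N+2)^m over [cos rho, 1], where m = |k|. Write
    Q_N for the m-th derivative of P_N. The two functions solve Sturm-Liouville
    equations with eigenvalues differing by 4N + 6, so this integral is
    (1 - x^2)^(m+1) W_N(x) / (4N + 6) at x = cos rho, with the Wronskian
    W_N = Q_N Q_(N+2)' - Q_N' Q_(N+2) (wronskian_deriv, overlap_gt0). The Q_N
    of one parity are orthogonal polynomials in x^2; the confluent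
    Christoffel-Darboux recursion
    alpha W_N = 2 K x Q_N^2 + gamma W_(N-2), with positive alpha, K and gamma,
    shows W_N > 0 on (0, oo) (wronskian_gt0).

    Sobolev regularity. With u the coordinate along xi, the Fourier transform of
    a disc is a one-dimensional Fourier integral of a chord length
    sqrt(A^2 - u^2). Shifting u by half a period h = pi/k in both directions
    turns 4 times that integral into the integral of an oscillation against the
    second difference of the chord length; by concavity the second difference is
    nonnegative away from the ends +-A, its total integral vanishes, and so its
    L^1 norm is controlled by two layers of width 2h in which the chord length
    is O(sqrt h) (chord_fourier_bound). Hence the transform decays like
    |xi|^(-3/2), which suffices for every exponent below 1/2; the exponent 3/8
    is used here. Instead of rotating the coordinates, a shear moves the
    frequency onto one axis: it preserves area by Fubini and translation
    invariance, and it still turns disc sections into chords of a disc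
    (disc_transform_shear). *)

(** * Derivatives of Legendre polynomials *)

Section Legendre.
Variable R : realType.
Implicit Types (N n k m : nat) (x : R).

Lemma derivnXM (p : {poly R}) k :
  ('X * p)^`(k.+1) = 'X * p^`(k.+1) + k.+1%:R * p^`(k).
Proof.
elim: k => [|k IHk]; first by rewrite !derivn1 derivM derivX !mul1r addrC.
rewrite derivnS IHk derivD derivM derivX -!derivnS.
rewrite mulr_natl derivMn -derivnS -[in RHS]mulr_natl.
rewrite (_ : k.+2%:R = k.+1%:R + 1 :> {poly R}) ?natr1 //.
rewrite -[in X in _ + X]mulr_natl; ring.
Qed.

Lemma derivnXderiv (p : {poly R}) k :
  ('X * p^`())^`(k) = 'X * p^`(k.+1) + k%:R * p^`(k).
Proof.
case: k => [|k]; first by rewrite derivn0 derivn1 mul0r addr0.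
by rewrite derivnXM -!derivSn.
Qed.

Lemma derivn_natM (p : {poly R}) (n k : nat) :
  (n%:R * p)^`(k) = n%:R * p^`(k).
Proof. by rewrite !mulr_natl derivnMn. Qed.

(** The polynomial whose N-th derivative is P_N; the recurrences of the Legendre
    polynomials are derivatives of two relations between these. *)
Definition rodrigues N : {poly R} := (2 ^+ N * N`!%:R)^-1 *: ('X^2 - 1) ^+ N.

(** P_N^(m) as one single derivative, so that the case m = 0 of the recurrences
    needs no antiderivative of P_N. *)
Definition legendre_derivn m N : {poly R} := (rodrigues N)^`(N + m).

Lemma legendre_derivnE m N : (legendre R N)^`(m) = legendre_derivn m N.
Proof.
by rewrite /legendre /legendre_derivn /rodrigues addnC [RHS]derivnZ /derivn iterD -/(derivn _ _) -/(derivn _ _) derivnZ.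
Qed.

Lemma deriv_legendre_derivn m N : (legendre_derivn m N)^`() = legendre_derivn m.+1 N.
Proof. by rewrite /legendre_derivn addnS derivnS. Qed.

Lemma rodriguesS N :
  (2 * N.+1%:R) * rodrigues N.+1 = ('X^2 - 1) * rodrigues N.
Proof.
rewrite /rodrigues factS -!mul_polyC.
have -> : 2 * N.+1%:R = (2 * N.+1%:R : R)%:P :> {poly R}.
  by rewrite polyCM !polyCMn.
have -> : (2 ^+ N.+1 * (N.+1 * N`!)%N%:R)^-1 = (2 * N.+1%:R)^-1 * (2 ^+ N * N`!%:R)^-1 :> R.
  by rewrite exprS natrM -invfM; congr (_^-1); ring.
rewrite [in LHS]mulrA -polyCM mulrA divff ?mul1r; last first.
  by rewrite mulf_neq0 ?pnatr_eq0.
by rewrite exprS; ring.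
Qed.

Lemma deriv_rodriguesS N : (rodrigues N.+1)^`() = 'X * rodrigues N.
Proof.
rewrite /rodrigues derivZ deriv_exp derivB derivXn derivC subr0 factS -!mul_polyC /=.
have -> : (2 ^+ N.+1 * (N.+1 * N`!)%N%:R)^-1 = (2 * N.+1%:R)^-1 * (2 ^+ N * N`!%:R)^-1 :> R.
  by rewrite exprS natrM -invfM; congr (_^-1); ring.
have E : (2 * N.+1%:R)^-1%:P * (2 * N.+1%:R) = 1 :> {poly R}.
  have -> : 2 * N.+1%:R = (2 * N.+1%:R : R)%:P :> {poly R}.
    by rewrite polyCM !polyCMn.
  by rewrite -polyCM mulVf // mulf_neq0 ?pnatr_eq0.
rewrite polyCM expr1 -(mulr_natl (_ * _ ^+ _) N.+1) -(mulr_natl 'X 2).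
by rewrite -[RHS]mul1r -[X in _ = X * _]E; ring.
Qed.

Lemma derivn_rodriguesS N k :
  (rodrigues N.+1)^`(k.+2) = 'X * (rodrigues N)^`(k.+1) + k.+1%:R * (rodrigues N)^`(k).
Proof. by rewrite derivSn deriv_rodriguesS derivnXM. Qed.

(** Up to derivatives, this is P_(N+2)' = (2N + 3) P_(N+1) + P_N'. *)
Lemma derivn_rodriguesSS N k :
  (rodrigues N.+2)^`(k.+2) =
  (2 * N + 3)%:R * (rodrigues N.+1)^`(k) + (rodrigues N)^`(k).
Proof.
rewrite derivSn deriv_rodriguesS derivSn derivM derivX deriv_rodriguesS mul1r.
have -> : rodrigues N.+1 + 'X * ('X * rodrigues N) =
   (2 * N + 3)%:R * rodrigues N.+1 + rodrigues N.
  have := rodriguesS N; rewrite -(natr1 N) => H; rewrite natrD natrM.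
  have -> : 'X * ('X * rodrigues N) =
    ('X^2 - 1) * rodrigues N + rodrigues N by ring.
  by rewrite -H; ring.
by rewrite derivnD derivn_natM.
Qed.

(** The three-term recurrence follows by eliminating the k-th derivative of
    rodrigues n.+1 from derivn_rodriguesS and derivn_rodriguesSS. *)
Lemma legendre_derivn_rec m n :
  (n.+2%:R - m%:R) * legendre_derivn m n.+2 =
  (2 * n + 3)%:R * 'X * legendre_derivn m n.+1 - (n.+1 + m)%:R * legendre_derivn m n.
Proof.
have H1 := derivn_rodriguesS n.+1 (n + m).
have H2 := derivn_rodriguesSS n (n + m).
rewrite /legendre_derivn !addSn; set a := (rodrigues n.+2)^`(_) in H1 H2 *.
set b := (rodrigues n.+1)^`((n + m).+1) in H1 *.
set c := (rodrigues n.+1)^`(n + m) in H1 H2.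
set d := (rodrigues n)^`(n + m) in H2 *.
have -> : d = a - (2 * n + 3)%:R * c by rewrite H2; ring.
have E : (2 * n + 3)%:R * ('X * b) = (2 * n + 3)%:R * (a - (n + m).+1%:R * c).
  by rewrite H1; congr (_ * _); ring.
rewrite -mulrA E -(natr1 n.+1) -(natr1 n) -(natr1 (n + m)).
by rewrite (natrD _ n m) (natrD _ (2 * n)) natrM; ring.
Qed.

Lemma size_rodrigues N : (size (rodrigues N) <= (2 * N).+1)%N.
Proof.
rewrite /rodrigues (leq_trans (size_scale_leq _ _)) //.
rewrite (leq_trans (size_poly_exp_leq _ _)) //.
by rewrite -[X in 'X^2 - X]polyC1 size_XnsubC.
Qed.

Lemma legendre_derivn_eq0 m N : (N < m)%N -> legendre_derivn m N = 0.
Proof.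
move=> Nm; apply: derivn_poly0; rewrite (leq_trans (size_rodrigues N)) //.
by rewrite mul2n -addnn -addnS leq_add2l.
Qed.

Lemma legendre_derivn_diagS m : legendre_derivn m.+1 m.+1 = (2 * m + 1)%:R * legendre_derivn m m.
Proof.
have := derivn_rodriguesS m (m + m).
rewrite /legendre_derivn addSn addnS => ->.
rewrite -[X in 'X * X]/((rodrigues m)^`((m + m).+1)) -addnS.
rewrite -[(rodrigues m)^`(m + m.+1)]/(legendre_derivn m.+1 m) legendre_derivn_eq0 // mulr0 add0r.
by rewrite mul2n -addnn addn1 -addnS.
Qed.

Lemma legendre_derivn_diag m : exists2 c : R, 0 < c & legendre_derivn m m = c%:P.
Proof.
elim: m => [|m [c c0 E]].
  exists 1 => //.
  by rewrite /legendre_derivn /rodrigues derivn0 !expr0 fact0 mul1r invr1 scale1r.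
exists ((2 * m + 1)%:R * c); first by rewrite mulr_gt0 // ltr0n addn1.
by rewrite legendre_derivn_diagS E polyCM !polyCMn.
Qed.

(** The three-term recurrence with P_(-1) = 0. *)
Lemma legendre_derivn_rec1 m : (1 - m%:R) * legendre_derivn m 1 = 'X * legendre_derivn m 0.
Proof.
case: m => [|[|m]].
- by rewrite subr0 mul1r /legendre_derivn addn0 derivn1 deriv_rodriguesS derivn0.
- by rewrite subrr mul0r legendre_derivn_eq0 ?mulr0.
- by rewrite !legendre_derivn_eq0 ?mulr0.
Qed.

Definition wronskian (p q : {poly R}) : {poly R} := p * q^`() - p^`() * q.

(** Confluent Christoffel-Darboux step: in the Wronskian of p and q the
    term be p of q drops out, and the derivative of 'X^2 leaves a square. *)
Lemma wronskian_step (p q r : {poly R}) (al K be ga : R) :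
  al%:P * q = (K%:P * 'X^2 - be%:P) * p - ga%:P * r ->
  al%:P * wronskian p q = 2 * K%:P * 'X * p ^+ 2 + ga%:P * wronskian r p.
Proof.
move=> E.
have E' : al%:P * q^`() =
    2 * K%:P * 'X * p + (K%:P * 'X^2 - be%:P) * p^`() - ga%:P * r^`().
  have := congr1 (@deriv R) E.
  by rewrite !(derivM, derivB, derivC, derivX) => H; ring: H.
by rewrite /wronskian mulrBr mulrCA E' [X in _ - X]mulrCA E; ring.
Qed.

(** Three consecutive three-term recurrences relate every other polynomial;
    eliminate q1 and q3. *)
Lemma two_step_rec (q0 q1 q2 q3 q4 : {poly R}) (a1 b1 c1 a2 b2 c2 a3 b3 c3 : R) :
  a1%:P * q2 = b1%:P * 'X * q1 - c1%:P * q0 ->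
  a2%:P * q3 = b2%:P * 'X * q2 - c2%:P * q1 ->
  a3%:P * q4 = b3%:P * 'X * q3 - c3%:P * q2 ->
  (a2 * a3 * b1)%:P * q4 =
    ((b1 * b2 * b3)%:P * 'X^2 - (a1 * b3 * c2 + a2 * b1 * c3)%:P) * q2
    - (b3 * c2 * c1)%:P * q0.
Proof.
move=> E1 E2 E3; rewrite !(polyCD, polyCM).
have -> : a2%:P * a3%:P * b1%:P * q4 = a2%:P * b1%:P * (a3%:P * q4) by ring.
have -> : b3%:P * c2%:P * c1%:P * q0 = b3%:P * c2%:P * (b1%:P * 'X * q1 - a1%:P * q2).
  by rewrite E1; ring.
rewrite E3.
have -> : a2%:P * b1%:P * (b3%:P * 'X * q3 - c3%:P * q2) =
  b1%:P * b3%:P * 'X * (a2%:P * q3) - a2%:P * b1%:P * c3%:P * q2 by ring.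
by rewrite E2; ring.
Qed.

(** The Q_(N-2) of the recurrence, with Q_(-1) = Q_(-2) = 0. *)
Definition legendre_derivn_pred2 m N : {poly R} := if N is n.+2 then legendre_derivn m n else 0.

Lemma legendre_derivn_recC m n :
  (n.+2%:R - m%:R)%:P * legendre_derivn m n.+2 =
  (2 * n + 3)%:R%:P * 'X * legendre_derivn m n.+1 - (n.+1 + m)%:R%:P * legendre_derivn m n.
Proof. by rewrite polyCB !polyC_natr legendre_derivn_rec. Qed.

(** The signs are what matters: the coefficients of the three-term recurrences
    that enter al, K and ga are positive for m <= N. For N < 2 the last term
    vanishes and its coefficient is free to be 1. *)
Lemma legendre_derivn_even_rec m N : (m <= N)%N ->
  exists al K be ga : R, [/\ 0 < al, 0 < K, 0 < ga &
   al%:P * legendre_derivn m N.+2 =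
     (K%:P * 'X^2 - be%:P) * legendre_derivn m N - ga%:P * legendre_derivn_pred2 m N].
Proof.
move=> mN.
have E3 := legendre_derivn_recC m N.
have p3 : 0 < N.+2%:R - m%:R :> R by rewrite subr_gt0 ltr_nat ltnS leqW.
have p2 : 0 < N.+1%:R - m%:R :> R by rewrite subr_gt0 ltr_nat ltnS.
have pos k : 0 < (k.+1)%:R :> R by rewrite ltr0n.
case: N mN E3 p3 p2 => [|[|n]] mN E3 p3 p2 /=.
  (* N = 0: the recurrence below the bottom is the trivial 0 Q_0 = X 0 *)
- have E2 : (1 - m%:R)%:P * legendre_derivn m 1 = 1%:P * 'X * legendre_derivn m 0 - 0%:P * 0.
    by rewrite polyCB !polyC_natr legendre_derivn_rec1 polyC1 mul1r mulr0 subr0.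
  have E1 : 0%:P * legendre_derivn m 0 = 1%:P * 'X * 0 - 0%:P * 0.
    by rewrite !mulr0 subr0 mul0r.
  have E := two_step_rec E1 E2 E3.
  rewrite [X in _ = _ - X]mulr0 -[X in _ = _ - X](mulr0 1%:P) in E.
  by do 4 eexists; split; last exact: E; rewrite ?ltr01 ?mulr_gt0.
- have E1 : (1 - m%:R)%:P * legendre_derivn m 1 = 1%:P * 'X * legendre_derivn m 0 - 0%:P * 0.
    by rewrite polyCB !polyC_natr legendre_derivn_rec1 polyC1 mul1r mulr0 subr0.
  have E2 := legendre_derivn_recC m 0.
  have E := two_step_rec E1 E2 E3.
  rewrite [X in _ = _ - X]mulr0 -[X in _ = _ - X](mulr0 1%:P) in E.
  by do 4 eexists; split; last exact: E; rewrite ?ltr01 ?mulr_gt0.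
- have E1 := legendre_derivn_recC m n.
  have E2 := legendre_derivn_recC m n.+1.
  have E := two_step_rec E1 E2 E3.
  by do 4 eexists; split; last exact: E; rewrite !mulr_gt0 // ?addSn ?addnS ?pos.
Qed.

(** Induction through wronskian_step. For N >= m + 2 the previous Wronskian is
    positive and the square may vanish at x; for N = m and N = m + 1 the previous
    polynomial is zero, and Q_m is a constant and Q_(m+1) a multiple of X, so the
    square is positive. *)
Lemma wronskian_gt0 m N x : 0 < x -> (m <= N)%N ->
  0 < (wronskian (legendre_derivn m N) (legendre_derivn m N.+2)).[x].
Proof.
move=> x0; elim/ltn_ind: N => N IH mN.
have [al [K [be [ga [al0 K0 ga0 /wronskian_step E]]]]] := legendre_derivn_even_rec mN.
rewrite -(pmulr_rgt0 _ al0) -hornerCM E hornerD hornerCM.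
have -> : (2 * K%:P * 'X * legendre_derivn m N ^+ 2).[x] = 2 * K * x * (legendre_derivn m N).[x] ^+ 2.
  by rewrite !hornerE.
have p0 : 0 <= 2 * K * x * (legendre_derivn m N).[x] ^+ 2.
  by rewrite mulr_ge0 ?sqr_ge0 // !mulr_ge0 ?ltW.
have [mN2|] := leqP m.+2 N.
  apply: ltr_wpDl => //; rewrite mulr_gt0 //.
  case: N mN IH mN2 {E p0} => [|[|n]] // mN IH mn.
  by apply: IH => //.
rewrite ltnS leq_eqVlt ltnS => Nm.
have -> : wronskian (legendre_derivn_pred2 m N) (legendre_derivn m N) = 0.
  have -> : legendre_derivn_pred2 m N = 0.
    case: N {IH E p0} mN Nm => [|[|n]] //= mN Nm.
    by rewrite legendre_derivn_eq0 //; case/orP: Nm => [/eqP[<-]|/ltnW].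
  by rewrite /wronskian derivC !mul0r subr0.
rewrite horner0 mulr0 addr0 pmulr_rgt0; last by rewrite !mulr_gt0.
rewrite exprn_even_gt0 //=.
have [c c0 Em] := legendre_derivn_diag m.
have {IH E p0} [->|->] : N = m \/ N = m.+1.
- by case/orP: Nm => [/eqP[->]|]; [right|left; apply/eqP; rewrite eqn_leq mN andbT].
- by rewrite Em hornerC gt_eqF.
have : (m.+1%:R - m%:R)%:P * legendre_derivn m m.+1 = (2 * m + 1)%:R%:P * 'X * legendre_derivn m m.
  case: (m) => [|n].
    by rewrite muln0 add0n subr0 polyC1 -mulrA !mul1r -legendre_derivn_rec1 subr0 mul1r.
  by rewrite legendre_derivn_recC [legendre_derivn n.+1 n]legendre_derivn_eq0 // mulr0 subr0 mulnS addnAC addnC.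
rewrite -natr1 addrAC subrr add0r polyC1 mul1r => ->.
by rewrite Em !hornerE gt_eqF // !mulr_gt0 // ltr0n addn1.
Qed.

(** The Gegenbauer equation: N + m + 1 derivatives of
    (X^2 - 1) u' = 2 N X u, where u is a multiple of (X^2 - 1)^N. *)
Lemma legendre_derivn_ode m N :
  (1 - 'X^2) * legendre_derivn m.+2 N =
  2 * m.+1%:R * 'X * legendre_derivn m.+1 N + (m%:R - N%:R) * (N + m).+1%:R * legendre_derivn m N.
Proof.
have H0 : 'X * ('X * (rodrigues N)^`()) - (rodrigues N)^`() = (2 * N)%:R * ('X * rodrigues N).
  case: N => [|n].
    by rewrite muln0 /rodrigues expr0 derivZ derivC scaler0 !mulr0 subrr mul0r.
  rewrite deriv_rodriguesS natrM.
  have -> : 2 * n.+1%:R * ('X * rodrigues n.+1) = 'X * (2 * n.+1%:R * rodrigues n.+1) by ring.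
  by rewrite rodriguesS; ring.
have := congr1 (fun p => p^`((N + m).+1)) H0.
rewrite derivnB derivn_natM !derivnXM -!derivSn /legendre_derivn !addnS.
rewrite derivnXderiv; set a := derivn _.+2 _; set b := derivn _.+1 _; set d := derivn _ _.
rewrite -(natr1 (N + m)) -(natr1 m) natrM natrD => E.
have -> : (1 - 'X^2) * a = - ('X * ('X * a + (N%:R + m%:R + 1) * b) +
    (N%:R + m%:R + 1) * ('X * b + (N%:R + m%:R) * d) - a) + ((N%:R + m%:R + 1) * 2) * 'X * b +
    (N%:R + m%:R + 1) * (N%:R + m%:R) * d by ring.
by rewrite E; ring.
Qed.

(** The difference of the two Sturm-Liouville equations; 4N + 6 is
    (N+2)(N+3) - N(N+1). *)
Lemma wronskian_deriv m N :
  ((1 - 'X^2) ^+ m.+1 * wronskian (legendre_derivn m N) (legendre_derivn m N.+2))^`() =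
  - (4 * N + 6)%:R * (1 - 'X^2) ^+ m * (legendre_derivn m N * legendre_derivn m N.+2).
Proof.
have O1 := legendre_derivn_ode m N.
have O2 := legendre_derivn_ode m N.+2.
rewrite /wronskian derivM deriv_exp /= !(derivM, derivB, derivX, derivC).
rewrite !deriv_legendre_derivn -[_ *+ m.+1]mulr_natl (exprS _ m).
set p := legendre_derivn m N in O1 *; set q := legendre_derivn m N.+2 in O2 *.
set p1 := legendre_derivn m.+1 N in O1 *; set q1 := legendre_derivn m.+1 N.+2 in O2 *.
set p2 := legendre_derivn m.+2 N in O1 *; set q2 := legendre_derivn m.+2 N.+2 in O2 *.
set w := (1 - 'X^2) ^+ m.
rewrite [LHS](_ : _ =
  w * (p * ((1 - 'X^2) * q2) - ((1 - 'X^2) * p2) * q - 2 * m.+1%:R * 'X * (p * q1 - p1 * q))); last by ring.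
rewrite O1 O2 -(natr1 (N.+2 + m)) -(natr1 (N + m)).
rewrite (natrD _ N.+2 m) (natrD _ N m) (natrD _ (4 * N)) natrM -(natr1 N.+1) -(natr1 N).
by ring.
Qed.

End Legendre.

(** * The overlap of two Legendre functions on [0, rho] *)

Section Integrals1D.
Variable R : realType.
Notation mu := (@lebesgue_measure R).

Lemma continuous_integrable_itv (f : R -> R) (a b : R) : continuous f ->
  mu.-integrable `[a, b] (EFin \o f).
Proof.
move=> cf; apply: continuous_compact_integrable; first exact: segment_compact.
exact: continuous_subspaceT.
Qed.

Lemma Rintegral_FTC (f F : R -> R) (a b : R) : a < b -> continuous f ->
  (forall x : R, is_derive x (1:R) F (f x)) ->
  \int[mu]_(x in `[a, b]) f x = F b - F a.
Proof.
move=> ab cf dF; rewrite /Rintegral (@continuous_FTC2 _ f F) //.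
- exact: continuous_subspaceT.
- have cF : continuous F by move=> x; apply/differentiable_continuous/derivable1_diffP; apply: ex_derive.
  split => [x _||]; first exact: ex_derive.
  + by apply: cvg_at_right_filter; exact: cF.
  + by apply: cvg_at_left_filter; exact: cF.
- by move=> x _; rewrite derive1E derive_val.
Qed.

Lemma is_derive_horner_cos (p : {poly R}) (x : R) :
  is_derive x (1:R) (fun t : R => p.[cos t]) (- (p^`()).[cos x] * sin x).
Proof.
have := is_derive1_comp (is_derive_poly p (cos x)) (is_derive_cos x).
by rewrite mulrN -mulNr.
Qed.

Lemma continuous_horner_cos (p : {poly R}) : continuous (fun t : R => p.[cos t]).
Proof.
move=> x; apply/differentiable_continuous/derivable1_diffP.
exact: (@ex_derive _ _ _ _ _ _ _ (is_derive_horner_cos p x)).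
Qed.

(** By wronskian_deriv the integrand is, up to 4N + 6, the derivative of
    Phi (cos t), where Phi = (1 - X^2)^(m+1) W vanishes at cos 0 = 1. *)
Lemma overlap_gt0 m N (rho : R) : 0 < rho -> rho < pi / 2 -> (m <= N)%N ->
  0 < \int[mu]_(t in `[0, rho])
        (((1 - 'X^2) ^+ m * (legendre_derivn R m N * legendre_derivn R m N.+2)).[cos t] * sin t).
Proof.
move=> r0 rpi mN.
set w := (1 - 'X^2) ^+ m * _.
pose Phi := (1 - 'X^2) ^+ m.+1 * wronskian (legendre_derivn R m N) (legendre_derivn R m N.+2).
have K0 : 0 < (4 * N + 6)%:R :> R by rewrite ltr0n addnS.
have PhiE : Phi^`() = - ((4 * N + 6)%:R *: w).
  by rewrite wronskian_deriv -mulrA -/w mulNr scaler_nat mulr_natl.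
have cf : continuous (fun t : R => (4 * N + 6)%:R * (w.[cos t] * sin t)).
  move=> t; apply: cvgM; first exact: cvg_cst.
  by apply: cvgM; [exact: continuous_horner_cos|exact: continuous_sin].
have dPhi (x : R) : is_derive x (1:R) (fun t => Phi.[cos t]) ((4 * N + 6)%:R * (w.[cos x] * sin x)).
  have := is_derive_horner_cos Phi x.
  by rewrite PhiE hornerN opprK hornerZ mulrA.
have int : mu.-integrable `[0, rho] (EFin \o (fun t => w.[cos t] * sin t)).
  apply: continuous_integrable_itv => t.
  by apply: cvgM; [exact: continuous_horner_cos|exact: continuous_sin].
rewrite -(pmulr_rgt0 _ K0) -RintegralZl // (Rintegral_FTC r0 cf dPhi).
have c0 : 0 < cos rho.
  by apply: cos_gt0_pihalf; rewrite rpi (lt_trans _ r0) // oppr_lt0 divr_gt0 ?pi_gt0.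
have c1 : cos rho < 1.
  rewrite -[X in _ < X]cos0 ltr_cos ?in_itv/= ?lexx ?pi_ge0 ?(ltW r0) //=.
  by rewrite ltW // (lt_trans rpi) // ltr_pdivrMr // mulr_natr mulr2n ltrDl pi_gt0.
have Phi1 : Phi.[1] = 0.
  have E1 : (1 - 'X^2 : {poly R}).[1] = 0 by rewrite !hornerE /=; ring.
  by rewrite /Phi hornerM horner_exp E1 expr0n mul0r.
have E2 : 0 < (1 - 'X^2 : {poly R}).[cos rho] by rewrite !(hornerD,hornerN,hornerXn,hornerC) subr_gt0 expr_lt1 ?ltW.
rewrite cos0 Phi1 subr0 /Phi hornerM horner_exp.
by rewrite mulr_gt0 ?wronskian_gt0 // exprn_gt0.
Qed.

Lemma assoc_legendre_natM N m (x : R) : `|x| <= 1 ->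
  assoc_legendre_nat N.+2 m x * assoc_legendre_nat N m x =
  ((1 - 'X^2) ^+ m * (legendre_derivn R m N * legendre_derivn R m N.+2)).[x].
Proof.
move=> x1; rewrite /assoc_legendre_nat !legendre_derivnE !hornerM horner_exp !(hornerD,hornerN,hornerXn,hornerC).
have E : Num.sqrt (1 - x ^+ 2) ^+ m * Num.sqrt (1 - x ^+ 2) ^+ m = (1 - x ^+ 2) ^+ m.
  by rewrite -exprMn -expr2 sqr_sqrtr // subr_ge0 -real_normK ?num_real // expr_le1.
have S : (-1) ^+ m * (-1) ^+ m = 1 :> R by rewrite -exprMn mulrNN mulr1 expr1n.
rewrite -E -[RHS]mul1r -[X in _ = X * _]S; ring.
Qed.

Lemma assoc_legendre_scale N (k : int) : exists2 c : R, c != 0 &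
  forall x, assoc_legendre N k x = c * assoc_legendre_nat N (absz k) x.
Proof.
case: k => k /=; first by exists 1 => [|x]; rewrite ?oner_eq0 ?mul1r.
exists ((-1) ^+ k.+1 * ((N - k.+1)`!%:R / (N + k.+1)`!%:R)) => //.
by rewrite mulf_neq0 ?signr_eq0 // mulf_neq0 ?invr_eq0 // pnatr_eq0 -lt0n fact_gt0.
Qed.

Lemma continuous_assoc_legendre N (k : int) :
  continuous (fun t : R => assoc_legendre N k (cos t)).
Proof.
have [c _ E] := assoc_legendre_scale N k.
under eq_fun do rewrite E.
move=> t; apply: cvgM; first exact: cvg_cst.
rewrite /assoc_legendre_nat; apply: cvgM; last exact: continuous_horner_cos.
apply: cvgM; first exact: cvg_cst.
have cs : continuous (fun t : R => Num.sqrt (1 - cos t ^+ 2)).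
  have -> : (fun t : R => Num.sqrt (1 - cos t ^+ 2)) =
            (fun t : R => Num.sqrt ((1 - 'X^2 : {poly R}).[cos t])).
    by apply/funext => u; rewrite !(hornerD,hornerN,hornerXn,hornerC).
  move=> u; apply: (@continuous_comp _ _ _ (fun t : R => (1 - 'X^2).[cos t]) (@Num.sqrt R)).
    exact: continuous_horner_cos.
  exact: sqrt_continuous.
elim: (absz k) => [|n IHn]; first exact: cvg_cst.
under eq_fun do rewrite exprS.
by rewrite exprS; apply: cvgM; [exact: cs|].
Qed.

End Integrals1D.

(** * Integrals over products and of complex-valued functions *)

Section ProductIntegral.
Variable R : realType.
Notation mu := (@lebesgue_measure R).

Lemma integrable_prodT (f g : R -> R) :
  mu.-integrable setT (EFin \o f) -> mu.-integrable setT (EFin \o g) ->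
  (lebesgue2 R).-integrable setT (EFin \o (fun p => f p.1 * g p.2)).
Proof.
move=> If Ig.
have mf : measurable_fun setT f by apply/measurable_EFinP; exact: measurable_int If.
have mg : measurable_fun setT g by apply/measurable_EFinP; exact: measurable_int Ig.
have mfg : measurable_fun setT (fun p : measurableTypeR R * measurableTypeR R => f p.1 * g p.2).
  by apply: measurable_funM; exact: measurableT_comp.
apply/integrable12ltyP; first exact/measurable_EFinP.
move/integrableP : If => [_ If]; move/integrableP : Ig => [_ Ig].
rewrite (_ : (\int[_]_x _)%E = (\int[mu]_x (`|(f x)%:E| * \int[mu]_y `|(g y)%:E|))%E).
  under eq_integral => x _ do rewrite muleC.
  rewrite ge0_integralZl//; last 2 first.
    by apply: measurableT_comp => //; exact/measurable_EFinP.
    exact: integral_ge0.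
  apply: lte_mul_pinfty => //; first exact: integral_ge0.
  by rewrite ge0_fin_numE // integral_ge0.
apply: eq_integral => x _ /=.
under eq_integral => y _ do rewrite normrM EFinM.
rewrite ge0_integralZl//.
by apply/measurable_EFinP; apply: measurableT_comp => //; exact: measurable_normr.
Qed.

Lemma Rintegral_prodT (f g : R -> R) :
  mu.-integrable setT (EFin \o f) -> mu.-integrable setT (EFin \o g) ->
  \int[lebesgue2 R]_p (f p.1 * g p.2) = (\int[mu]_x f x) * (\int[mu]_x g x).
Proof.
move=> If Ig.
rewrite {1}/Rintegral -(integral12_prod_meas1 (integrable_prodT If Ig)).
rewrite (_ : (\int[_]_x _)%E = (\int[mu]_x ((\int[mu]_y g y) * f x)%:E)%E).
  by rewrite -/(Rintegral _ _ _) RintegralZl // mulrC.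
apply: eq_integral => x _; rewrite /fubini_F /=.
under eq_integral => y _ do rewrite EFinM.
rewrite integralZl // mulrC EFinM; congr (_ * _)%E.
by rewrite /Rintegral fineK //; exact: integrable_fin_num.
Qed.

Lemma restrict_prod (A B : set (measurableTypeR R)) (f g : R -> R) :
  ((fun p : R * R => f p.1 * g p.2) \_ (A `*` B)) =
  (fun p => (f \_ A) p.1 * (g \_ B) p.2).
Proof.
apply/funext => -[x y]; rewrite /patch /= in_setX /=.
by case: (x \in A); case: (y \in B); rewrite ?mulr0 ?mul0r.
Qed.

Lemma integrable_prod (A B : set (measurableTypeR R)) (f g : R -> R) :
  measurable A -> measurable B ->
  mu.-integrable A (EFin \o f) -> mu.-integrable B (EFin \o g) ->
  (lebesgue2 R).-integrable (A `*` B) (EFin \o (fun p => f p.1 * g p.2)) /\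
  \int[lebesgue2 R]_(p in A `*` B) (f p.1 * g p.2) =
    (\int[mu]_(x in A) f x) * (\int[mu]_(x in B) g x).
Proof.
move=> mA mB If0 Ig0.
have If := (integrable_mkcond _ mA).1 If0.
have Ig := (integrable_mkcond _ mB).1 Ig0.
rewrite restrict_EFin in If; rewrite restrict_EFin in Ig.
split.
  apply/integrable_mkcond; first exact: measurableX.
  by rewrite restrict_EFin restrict_prod; exact: integrable_prodT.
by rewrite Rintegral_mkcond restrict_prod Rintegral_prodT // -!Rintegral_mkcond.
Qed.

End ProductIntegral.

Section ComplexIntegral.
Context (d : measure_display) (T : measurableType d) (R : realType)
  (mu : {measure set T -> \bar R}) (D : set T).
Hypothesis mD : measurable D.
Local Open Scope complex_scope.
Implicit Types (F G : T -> R[i]) (u v c : R[i]).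

(** Integrability is part of the predicate because linearity of the real
    integral requires it of every summand. *)
Definition has_cintegral F v :=
  [/\ mu.-integrable D (EFin \o (fun x => complex.Re (F x))),
      mu.-integrable D (EFin \o (fun x => complex.Im (F x))) &
      cintegral mu D F = v].

Lemma has_cintegral0 : has_cintegral (fun _ => 0) 0.
Proof.
split; [exact: integrable0|exact: integrable0|].
by rewrite /cintegral /= !Rintegral_cst // !mul0r.
Qed.

Lemma has_cintegralD F G u v : has_cintegral F u -> has_cintegral G v ->
  has_cintegral (fun x => F x + G x) (u + v).
Proof.
move=> [Fr Fi <-] [Gr Gi <-].
have ED : ((fun x => complex.Re (F x + G x)) = (fun x => complex.Re (F x) + complex.Re (G x))) *
  ((fun x => complex.Im (F x + G x)) = (fun x => complex.Im (F x) + complex.Im (G x))).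
  by split; apply/funext => x; case: (F x) (G x) => [a b] [e f].
rewrite /has_cintegral /cintegral !ED; split.
- exact: (integrableD mD Fr Gr).
- exact: (integrableD mD Fi Gi).
- by rewrite !RintegralD.
Qed.

Lemma has_cintegralZ F u c : has_cintegral F u -> has_cintegral (fun x => c * F x) (c * u).
Proof.
move=> [Fr Fi <-]; case: c => a b.
have ED : ((fun x => complex.Re ((a +i* b) * F x)) = (fun x => a * complex.Re (F x) - b * complex.Im (F x))) *
  ((fun x => complex.Im ((a +i* b) * F x)) = (fun x => a * complex.Im (F x) + b * complex.Re (F x))).
  by split; apply/funext => x; case: (F x) => [e f].
have IZ k (f : T -> R) : mu.-integrable D (EFin \o f) -> mu.-integrable D (EFin \o (fun x => k * f x)).
  by move=> If; have := integrableZl mD k If.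
rewrite /has_cintegral /cintegral !ED; split.
- exact: (integrableB mD (IZ a _ Fr) (IZ b _ Fi)).
- exact: (integrableD mD (IZ a _ Fi) (IZ b _ Fr)).
- by rewrite RintegralB ?RintegralD ?RintegralZl //; apply: IZ.
Qed.

Lemma has_cintegral_sum n (F : 'I_n -> T -> R[i]) (v : 'I_n -> R[i]) :
  (forall i, has_cintegral (F i) (v i)) ->
  has_cintegral (fun x => \sum_(i < n) F i x) (\sum_(i < n) v i).
Proof.
move=> H; elim: n F v H => [|n IH] F v H.
  by rewrite big_ord0; under eq_fun do rewrite big_ord0; exact: has_cintegral0.
rewrite big_ord_recl; under eq_fun do rewrite big_ord_recl.
by apply: has_cintegralD => //; apply: IH.
Qed.

Lemma eq_cintegral F G : {in D, F =1 G} -> cintegral mu D F = cintegral mu D G.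
Proof.
by move=> FG; congr (_ +i* _); apply: eq_Rintegral => x xD; rewrite FG.
Qed.

End ComplexIntegral.

Section Azimuthal.
Variable R : realType.
Local Open Scope complex_scope.
Notation mu := (@lebesgue_measure R).

Lemma continuous_mulint (n : int) : continuous (fun t : R => n%:~R * t).
Proof. by move=> x; apply: cvgM; [exact: cvg_cst|exact: cvg_id]. Qed.

Lemma continuous_cos_mulint (n : int) : continuous (fun t : R => cos (n%:~R * t)).
Proof.
move=> x; apply: (continuous_comp (@continuous_mulint n x)).
exact: continuous_cos.
Qed.

Lemma continuous_sin_mulint (n : int) : continuous (fun t : R => sin (n%:~R * t)).
Proof.
move=> x; apply: (continuous_comp (@continuous_mulint n x)).
exact: continuous_sin.
Qed.

Lemma integrable_azimuth (f : R -> R) : continuous f ->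
  mu.-integrable `[0, 2 * pi[ (EFin \o f).
Proof.
move=> cf; apply: integrableS (continuous_integrable_itv 0 (2 * pi) cf) => // y /=.
by rewrite !in_itv /= => /andP[-> /ltW ->].
Qed.

Lemma cexpi_integral (n : int) :
  \int[mu]_(x in `[0, 2 * pi[) cos (n%:~R * x) = (if n == 0 then 2 * pi else 0) /\
  \int[mu]_(x in `[0, 2 * pi[) sin (n%:~R * x) = 0 :> R.
Proof.
have p0 : 0 < 2 * pi :> R by rewrite mulr_gt0 ?pi_gt0.
have [->|n0] := eqVneq n 0.
  split; under eq_Rintegral do rewrite mul0r ?cos0 ?sin0;
    by rewrite Rintegral_cst //= lebesgue_measure_itv /= lte_fin p0 /= subr0 ?mul0r ?mul1r.
have n0' : n%:~R != 0 :> R by rewrite intr_eq0.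
have dlin (x : R) : is_derive x (1:R) (fun t : R => n%:~R * t) n%:~R.
  by have := is_deriveZ n%:~R (is_derive_id x 1); rewrite /GRing.scale /= mulr1.
have cc := @continuous_cos_mulint n.
have cs := @continuous_sin_mulint n.
have trig2pi : cos (n%:~R * (2 * pi)) = 1 :> R /\ sin (n%:~R * (2 * pi)) = 0 :> R.
  have nat2pi (k : nat) : cos (k%:R * (2 * pi)) = 1 :> R /\ sin (k%:R * (2 * pi)) = 0 :> R.
    elim: k => [|k [IHc IHs]]; first by rewrite mul0r cos0 sin0.
    rewrite -natr1 mulrDl mul1r [in X in _ + X]mulr_natl.
    by rewrite cosD2pi sinD2pi.
  case: {dlin cc cs} n n0 n0' => k _ _; first exact: nat2pi.
  by rewrite NegzE mulrNz mulNr cosN sinN; have [-> ->] := nat2pi k.+1; rewrite oppr0.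
have dsin (x : R) : is_derive x (1:R) (fun t => n%:~R^-1 * sin (n%:~R * t)) (cos (n%:~R * x)).
  have := is_deriveZ n%:~R^-1 (is_derive1_comp (is_derive_sin _) (dlin x)).
  by rewrite /GRing.scale /= mulrCA mulVf // mulr1.
have dcos (x : R) : is_derive x (1:R) (fun t => - n%:~R^-1 * cos (n%:~R * t)) (sin (n%:~R * x)).
  have := is_deriveZ (- n%:~R^-1) (is_derive1_comp (is_derive_cos _) (dlin x)).
  by rewrite /GRing.scale /= !mulNr mulrN opprK mulrCA mulVf // mulr1.
have icos := integrable_azimuth cc.
have isin := integrable_azimuth cs.
rewrite !Rintegral_itv_bndo_bndc //.
rewrite (Rintegral_FTC p0 cc dsin) (Rintegral_FTC p0 cs dcos).
by have [-> ->] := trig2pi; rewrite !mulr0 cos0 sin0 mulr0 !subrr.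
Qed.

(** Fubini separates the angles, and the integral over phi selects n = 0. *)
Lemma has_cintegral_azimuthal (n : int) (g : R -> R) (rho : R) : continuous g ->
  has_cintegral (lebesgue2 R) (`[0, 2 * pi[ `*` `[0, rho])
    (fun p => cexpi (n%:~R * p.1) * (g p.2)%:C)
    (if n == 0 then (2 * pi * \int[mu]_(t in `[0, rho]) g t)%:C else 0).
Proof.
move=> cg.
have Ig := continuous_integrable_itv 0 rho cg.
have cc := @continuous_cos_mulint n.
have cs := @continuous_sin_mulint n.
have [Ic Ec] := @integrable_prod _ `[0, 2 * pi[ `[0, rho] _ _ (measurable_itv _) (measurable_itv _) (integrable_azimuth cc) Ig.
have [Is Es] := @integrable_prod _ `[0, 2 * pi[ `[0, rho] _ _ (measurable_itv _) (measurable_itv _) (integrable_azimuth cs) Ig.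
have ER : ((fun p : R * R => complex.Re (cexpi (n%:~R * p.1) * (g p.2)%:C)) = (fun p => cos (n%:~R * p.1) * g p.2)) *
  ((fun p : R * R => complex.Im (cexpi (n%:~R * p.1) * (g p.2)%:C)) = (fun p => sin (n%:~R * p.1) * g p.2)).
  by split; apply/funext => p /=; rewrite mulr0 ?subr0 ?add0r.
rewrite /has_cintegral /cintegral !ER; split => //.
rewrite Ec Es; have [-> ->] := cexpi_integral n.
by case: ifP => _; rewrite !mul0r.
Qed.
End Azimuthal.

(** * Geometry of the circular cone *)

Section Geometry.
Variable R : realType.
Implicit Types (x : 'rV[R]_3) (rho theta phi : R).

Lemma vec3E (a b c : R) :
  (vec3 a b c 0 0 = a) * (vec3 a b c 0 1 = b) * (vec3 a b c 0 2%:R = c).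
Proof. by split; [split|]; rewrite mxE. Qed.

Lemma vec3_coord x : vec3 (x 0 0) (x 0 1) (x 0 2%:R) = x.
Proof.
apply/rowP => i; rewrite mxE.
case: i => -[|[|[|//]]] lti /=; congr (x _ _); exact: val_inj.
Qed.

Lemma polar_angle (a b : R) : a ^+ 2 + b ^+ 2 = 1 ->
  exists2 phi, 0 <= phi < 2 * pi & a = cos phi /\ b = sin phi.
Proof.
move=> ab1.
have a1 : -1 <= a <= 1.
  rewrite -ler_norml -(@expr_le1 _ 2) // real_normK ?num_real // -ab1.
  by rewrite lerDl sqr_ge0.
have sE : sin (acos a) = `|b|.
  by rewrite sin_acos // -ab1 addrAC subrr add0r sqrtr_sqr.
have p0 := pi_gt0 R.
have [b0|b0] := leP 0 b.
  exists (acos a); last by rewrite acosK // sE ger0_norm.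
  rewrite acos_ge0 //= (le_lt_trans (acos_lepi a1)) //.
  by rewrite mulr_natl mulr2n ltrDl.
exists (2 * pi - acos a); last first.
  rewrite mulr_natl addrC cosD2pi sinD2pi cosN sinN acosK // sE ltr0_norm //.
  by rewrite opprK.
have : 0 < acos a.
  rewrite lt_neqAle acos_ge0 // andbT eq_sym; apply/eqP => a0.
  by move: sE; rewrite a0 sin0 => /eqP; rewrite eq_sym normr_eq0 lt_eqF.
have := acos_lepi a1; move=> ? ?; apply/andP; split; lra.
Qed.

Lemma tan_gt0 rho : 0 < rho -> rho < pi / 2 -> 0 < tan rho.
Proof.
move=> r0 rpi; have p0 := pi_gt0 R.
by rewrite /tan divr_gt0 ?sin_gt0_pi ?cos_gt0_pihalf //; apply/andP; split; lra.
Qed.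

(** The difference of the two sides is sin (rho - theta) / cos rho, up to
    sign. *)
Lemma angle_leE rho theta : 0 < rho -> rho < pi / 2 -> 0 <= theta <= pi ->
  (sin theta <= tan rho * cos theta) = (theta <= rho).
Proof.
move=> r0 rpi /andP[t0 tpi].
have p0 := pi_gt0 R.
have c0 : 0 < cos rho by apply: cos_gt0_pihalf; apply/andP; split; lra.
rewrite /tan mulrAC ler_pdivlMr // -subr_ge0.
rewrite [sin theta * _]mulrC -sinB.
apply/idP/idP => [|tr].
  apply: contraTT; rewrite -!ltNge => rt.
  by rewrite -opprB sinN oppr_lt0 sin_gt0_pi //; lra.
by apply: sin_ge0_pi; lra.
Qed.

Lemma sphere_coneP rho theta : 0 < rho -> rho < pi / 2 -> 0 <= theta <= pi ->
  0 <= cos theta /\ sin theta ^+ 2 <= (tan rho * cos theta) ^+ 2 <-> theta <= rho.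
Proof.
move=> r0 rpi tpi; have k0 := tan_gt0 r0 rpi.
have st0 : 0 <= sin theta by apply: sin_ge0_pi.
rewrite -(angle_leE r0 rpi tpi); split=> [[ct0 st]|H].
  by rewrite -ler_sqr // nnegrE mulr_ge0 // ltW.
have ct0 : 0 <= cos theta.
  by rewrite -(pmulr_rge0 _ k0) (le_trans st0).
by split => //; rewrite ler_sqr // nnegrE mulr_ge0 // ltW.
Qed.

(** The Cartesian description of the cone, through which all the geometric
    conditions are checked. *)
Lemma circular_coneP rho x : 0 < rho -> rho < pi / 2 ->
  circular_cone rho x <->
  0 <= x 0 2%:R /\ (x 0 0) ^+ 2 + (x 0 1) ^+ 2 <= (tan rho * x 0 2%:R) ^+ 2.
Proof.
move=> rho0 rhopi; have p0 := pi_gt0 R; split.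
  move=> [r [theta [phi [r0 /andP[t0 tr] _ ->]]]].
  rewrite /spherical_point !vec3E.
  have tpi : 0 <= theta <= pi by apply/andP; split => //; lra.
  have [ct0 st] := (sphere_coneP rho0 rhopi tpi).2 tr.
  split; first exact: mulr_ge0.
  have -> : (r * sin theta * cos phi) ^+ 2 + (r * sin theta * sin phi) ^+ 2 =
    r ^+ 2 * sin theta ^+ 2 by rewrite !exprMn -mulrDr cos2Dsin2 mulr1.
  by rewrite [tan rho * _]mulrCA [X in _ <= X]exprMn ler_wpM2l ?sqr_ge0.
move: (vec3_coord x) => /esym; move: (x 0 0) (x 0 1) (x 0 2%:R) => a b c -> [c0 H].
pose s := Num.sqrt (a ^+ 2 + b ^+ 2).
have s0 : 0 <= s by exact: sqrtr_ge0.
have s2 : s ^+ 2 = a ^+ 2 + b ^+ 2 by rewrite sqr_sqrtr // addr_ge0 ?sqr_ge0.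
pose r := Num.sqrt (s ^+ 2 + c ^+ 2).
have r0 : 0 <= r by exact: sqrtr_ge0.
have r2 : r ^+ 2 = s ^+ 2 + c ^+ 2 by rewrite sqr_sqrtr // addr_ge0 ?sqr_ge0.
have [phi phi2 [aE bE]] : exists2 phi, 0 <= phi < 2 * pi & a = s * cos phi /\ b = s * sin phi.
  have [sz|sn0] := eqVneq s 0.
    exists 0; first by rewrite lexx mulr_gt0.
    move/eqP: s2; rewrite sz expr0n /= eq_sym paddr_eq0 ?sqr_ge0 //.
    by rewrite !sqrf_eq0 !mul0r => /andP[/eqP -> /eqP ->].
  have /polar_angle[phi phi2 [ca sb]] : (a / s) ^+ 2 + (b / s) ^+ 2 = 1.
    by rewrite !expr_div_n -mulrDl -s2 divff // sqrf_eq0.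
  by exists phi => //; rewrite -ca -sb !(mulrCA s) divff // !mulr1.
have [theta tpi [cE sE]] : exists2 theta, 0 <= theta <= pi & c = r * cos theta /\ s = r * sin theta.
  have [rz|rn0] := eqVneq r 0.
    exists 0; first by rewrite lexx ltW.
    move/eqP: r2; rewrite rz expr0n /= eq_sym paddr_eq0 ?sqr_ge0 //.
    by rewrite !sqrf_eq0 !mul0r => /andP[/eqP -> /eqP ->].
  have rp : 0 < r by rewrite lt_neqAle eq_sym rn0.
  have cr2 : 1 - (c / r) ^+ 2 = (s / r) ^+ 2.
    rewrite !expr_div_n; apply/eqP; rewrite subr_eq -mulrDl -r2 divff //.
    by rewrite sqrf_eq0.
  have cr1 : -1 <= c / r <= 1.
    rewrite -ler_norml -(@expr_le1 _ 2) // real_normK ?num_real //.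
    by rewrite -subr_ge0 cr2 sqr_ge0.
  exists (acos (c / r)); first by rewrite acos_ge0 // acos_lepi.
  rewrite sin_acos // acosK ?in_itv //= cr2 sqrtr_sqr ger0_norm ?divr_ge0 //.
  by rewrite !(mulrCA r) divff // !mulr1.
(* at the vertex theta is arbitrary and need not lie below rho *)
exists r, (if r == 0 then 0 else theta), phi; split => //; last first.
  rewrite /spherical_point; case: eqP => rz; last by rewrite -sE -cE -aE -bE.
  by rewrite aE bE sE cE rz !mul0r.
case: eqP => [_|/eqP rn0]; first by rewrite lexx ltW.
have rp : 0 < r by rewrite lt_neqAle eq_sym rn0.
case/andP: (tpi) => -> _ /=; apply/sphere_coneP => //.
move: c0 H; rewrite -s2 sE cE pmulr_rge0 // => c0.
by rewrite [tan rho * _]mulrCA !(exprMn _ r) ler_pM2l // exprn_gt0.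
Qed.

Lemma sphere_circular_cone rho theta phi : 0 < rho -> rho < pi / 2 -> 0 <= theta <= pi ->
  circular_cone rho (spherical_point 1 theta phi) <-> theta <= rho.
Proof.
move=> rho0 rhopi tpi; rewrite circular_coneP // -sphere_coneP //.
rewrite /spherical_point !vec3E !mul1r.
have -> // : (sin theta * cos phi) ^+ 2 + (sin theta * sin phi) ^+ 2 = sin theta ^+ 2.
by rewrite !exprMn -mulrDr cos2Dsin2 mulr1.
Qed.

Lemma circular_cone_closed rho : 0 < rho -> rho < pi / 2 -> closed (circular_cone rho).
Proof.
move=> r0 rpi.
have -> : circular_cone rho = (fun x => x 0 2%:R) @^-1` [set t | 0 <= t] `&`
   (fun x => (tan rho * x 0 2%:R) ^+ 2 - ((x 0 0) ^+ 2 + (x 0 1) ^+ 2)) @^-1` [set t | 0 <= t].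
  apply/seteqP; split => x /=; rewrite circular_coneP //= subr_ge0 //.
have cc (i : 'I_3) : continuous (fun x : 'rV[R]_3 => x 0 i) by exact: coord_continuous.
apply: closedI; apply: closed_comp; do ?exact: closed_ge; move=> x _; first exact: cc.
have sq (f : 'rV[R]_3 -> R) : continuous f -> continuous (fun x => f x ^+ 2).
  move=> cf y; have -> : (fun x => f x ^+ 2) = (fun x => f x * f x) by apply/funext => z; rewrite expr2.
  exact: (@cvgM _ _ _ _ f f _ _ (cf y) (cf y)).
have sk : continuous (fun x : 'rV[R]_3 => (tan rho * x 0 2%:R) ^+ 2).
  apply: (sq (fun x => tan rho * x 0 2%:R)) => y.
  exact: (cvgM (cvg_cst (tan rho)) (cc 2%:R y)).
exact: (cvgB (sk x) (cvgD (sq _ (cc 0) x) (sq _ (cc 1) x))).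
Qed.

Lemma circular_coneZ rho (t : R) x : 0 < rho -> rho < pi / 2 ->
  0 <= t -> circular_cone rho x -> circular_cone rho (t *: x).
Proof.
move=> r0 rpi t0; rewrite !circular_coneP // !mxE => -[c0 H].
split; first exact: mulr_ge0.
by rewrite [tan rho * _]mulrCA !(exprMn _ t) -mulrDr ler_wpM2l ?sqr_ge0.
Qed.

(** The exterior is star-shaped about e = (0, 0, -1): moving towards e lowers
    the third coordinate faster than the distance to the axis, so a segment that
    starts outside the cone never enters it. *)
Lemma circular_cone_exterior_connected rho : 0 < rho -> rho < pi / 2 ->
  connected (~` circular_cone rho).
Proof.
move=> r0 rpi; have k0 := tan_gt0 r0 rpi.
pose e : 'rV[R]_3 := vec3 0 0 (-1).
pose seg x := (fun t : R => x + t *: (e - x)) @` `[0, 1].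
have -> : ~` circular_cone rho = \bigcup_(x in ~` circular_cone rho) seg x.
  apply/seteqP; split => [x xC|y [x xC [t]]].
    by exists x => //; exists 0; rewrite /= ?in_itv/= ?lexx ?ler01 // scale0r addr0.
  rewrite /= in_itv /= => /andP[t0 t1] <- /=.
  move=> /(circular_coneP _ r0 rpi).
  rewrite !mxE /= => -[h0 H]; apply: xC; apply/(circular_coneP _ r0 rpi).
  have t1' : t < 1.
    rewrite lt_neqAle t1 andbT; apply/eqP => tE; move: h0; rewrite tE; lra.
  set a := x 0 0 in H *; set b := x 0 1 in H *; set c := x 0 2%:R in h0 H *.
  have u0 : 0 < 1 - t by rewrite subr_gt0.
  have hE : c + t * (-1 - c) = (1 - t) * c - t by ring.
  have c0 : 0 <= c.
    by rewrite -(pmulr_rge0 _ u0); move: h0; rewrite hE; lra.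
  split => //.
  have : (1 - t) ^+ 2 * (a ^+ 2 + b ^+ 2) <= (1 - t) ^+ 2 * (tan rho * c) ^+ 2.
    apply: le_trans (_ : (tan rho * (c + t * (-1 - c))) ^+ 2 <= _).
      by apply: le_trans H; rewrite le_eqVlt; apply/orP; left; apply/eqP; ring.
    rewrite -exprMn [X in _ <= X ^+ 2]mulrCA ler_sqr ?nnegrE; last 2 first.
    - exact: mulr_ge0 (ltW k0) h0.
    - exact: mulr_ge0 (ltW k0) (mulr_ge0 (ltW u0) c0).
    by rewrite (ler_pM2l k0) hE lerBlDr lerDl.
  by rewrite ler_pM2l // exprn_gt0.
apply: bigcup_connected.
  by exists e => x _; exists 1; rewrite /= ?in_itv/= ?lexx ?ler01 // scale1r addrC subrK.
move=> x _; apply: connected_continuous_connected; first exact: segment_connected.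
apply: continuous_subspaceT => t; apply: cvgD; first exact: cvg_cst.
by apply: cvgZl; exact: cvg_id.
Qed.

End Geometry.

(** * Detection of spherical harmonics *)

Section Detection.
Variable R : realType.
Local Open Scope complex_scope.
Notation mu := (@lebesgue_measure R).

Lemma overlap_assoc_neq0 N (k : int) (rho : R) : 0 < rho -> rho < pi / 2 ->
  (absz k <= N)%N ->
  \int[mu]_(t in `[0, rho])
     (assoc_legendre N.+2 (- k) (cos t) * assoc_legendre N k (cos t) * sin t) != 0.
Proof.
move=> r0 rpi kN.
have [c c0 cE] := assoc_legendre_scale R N k.
have [c' c'0 c'E] := assoc_legendre_scale R N.+2 (- k).
rewrite abszN in c'E.
set w := (1 - 'X^2) ^+ absz k * (legendre_derivn R (absz k) N * legendre_derivn R (absz k) N.+2).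
under eq_Rintegral => t _.
  rewrite cE c'E (_ : _ * _ * _ = c' * c * (w.[cos t] * sin t)); last first.
    have := assoc_legendre_natM N (absz k) (cos_max t).
    by rewrite -/w => <-; ring.
  over.
rewrite RintegralZl //; last first.
  apply: continuous_integrable_itv => t.
  by apply: cvgM; [exact: continuous_horner_cos|exact: continuous_sin].
by rewrite !mulf_neq0 // gt_eqF // overlap_gt0.
Qed.

(** The real factor in front of Ylm. *)
Definition Ynorm N (m : int) : R := (-1) ^+ absz m
   * Num.sqrt ((2 * N + 1)%:R / (4 * pi)
               * ((absz (N%:Z - m))`!%:R / (absz (N%:Z + m))`!%:R)).

Lemma Ynorm_neq0 N (m : int) : Ynorm N m != 0.
Proof.
rewrite mulf_neq0 ?signr_eq0 // sqrtr_eq0 -ltNge.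
by rewrite !mulr_gt0 ?invr_gt0 ?mulr_gt0 ?pi_gt0 ?ltr0n ?fact_gt0 // addn1.
Qed.

Lemma cexpiD (s t : R) : cexpi (s + t) = cexpi s * cexpi t.
Proof. by rewrite /cexpi cosD sinD; apply/eqP; rewrite eq_complex /= [_ * sin t + _]addrC !eqxx. Qed.

Lemma sphere_cap (rho : R) : 0 < rho -> rho < pi / 2 ->
  [set p : R * R | sphere_angles p /\ circular_cone rho (spherical_point 1 p.2 p.1)]
  = `[0, 2 * pi[ `*` `[0, rho].
Proof.
move=> r0 rpi; have p0 := pi_gt0 R; apply/seteqP; split => -[phi theta] /=; rewrite !in_itv /=.
  by move=> [[/= -> tpi] /(sphere_circular_cone _ r0 rpi tpi) ->]; case/andP: tpi => ->.
move=> [phi2 /andP[t0 tr]].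
have tpi : 0 <= theta <= pi by apply/andP; split => //; lra.
by split; [|apply/sphere_circular_cone].
Qed.

(** For a nonzero coefficient c k0 the test order is - mk k0: the azimuthal
    frequency of the k-th summand is then mk k - mk k0, which vanishes only for
    k = k0. *)
Lemma circular_cone_detects (rho : R) : 0 < rho -> rho < pi / 2 ->
  detects_spherical_harmonics (circular_cone rho).
Proof.
move=> r0 rpi N H [c Hc] [p0 p0S Hp0].
have [k0 ck0] : exists k, c k != 0.
  apply: contrapT => /forallNP cz; move/eqP: Hp0; apply.
  rewrite Hc // big1 // => k _; apply/eqP; rewrite mulf_eq0.
  by have /negP/negPn -> := cz k.
pose mk (k : 'I_(2 * N).+1) : int := k%:Z - N%:Z.
have mkN k : (absz (mk k) <= N)%N by rewrite /mk; case: k => k /= ; lia.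
exists (- mk k0).
  by have := mkN k0; lia.
rewrite /sphere_integral sphere_cap //.
pose g k (t : R) := assoc_legendre N.+2 (- mk k0) (cos t) * assoc_legendre N (mk k) (cos t) * sin t.
pose coef k := c k * (Ynorm N.+2 (- mk k0) * Ynorm N (mk k))%:C.
rewrite (@eq_cintegral _ _ _ (lebesgue2 R) _ _ (fun p => \sum_(k < (2 * N).+1)
  coef k * (cexpi ((mk k - mk k0)%:~R * p.1) * (g k p.2)%:C))); last first.
  move=> p; rewrite inE => pD.
  rewrite Hc; last first.
    by move: pD; rewrite -sphere_cap // => -[].
  rewrite mulr_sumr mulr_suml; apply: eq_bigr => k _.
  rewrite /coef /g /Ylm -/(Ynorm _ _) -/(Ynorm _ _) -/(mk k).
  have -> : cexpi ((mk k - mk k0)%:~R * p.1) = cexpi ((- mk k0)%:~R * p.1) * cexpi ((mk k)%:~R * p.1).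
    by rewrite -cexpiD -mulrDl -intrD addrC.
  by rewrite !rmorphM /=; ring.
have cg k : continuous (g k).
  move=> t; apply: cvgM; last exact: continuous_sin.
  by apply: cvgM; exact: continuous_assoc_legendre.
have mD : measurable (`[0, 2 * pi[%classic `*` `[0, rho]%classic : set (measurableTypeR R * measurableTypeR R)).
  by apply: measurableX; exact: measurable_itv.
have HI k := has_cintegralZ mD (coef k) (has_cintegral_azimuthal (mk k - mk k0) rho (cg k)).
have [_ _ ->] := has_cintegral_sum mD HI.
rewrite (bigD1 k0) //= big1 ?addr0; last first.
  move=> k kk0; rewrite ifN ?mulr0 // /mk.
  apply: contra kk0 => /eqP kE; apply/eqP/val_inj => /=; lia.
rewrite subrr eqxx !mulf_neq0 //.
- rewrite eq_complex /= eqxx andbT mulf_neq0 ?Ynorm_neq0 //.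
- rewrite eq_complex /= eqxx andbT mulf_neq0 ?overlap_assoc_neq0 //.
  by rewrite mulf_neq0 // gt_eqF // pi_gt0.
Qed.
End Detection.

(** * Oscillatory integrals of chord lengths *)

Section Shift.
Variable R : realType.
Notation mu := (@lebesgue_measure R).
Notation RM := (measurableTypeR R).

Definition translate (a : R) (x : RM) : RM := x + a.

Lemma measurable_translate (a : R) : measurable_fun setT (translate a).
Proof. by apply: measurable_funD. Qed.

HB.instance Definition _ (a : R) :=
  isMeasurableFun.Build _ _ _ _ (translate a) (measurable_translate a).

Lemma lebesgue_measure_translate (a : R) (A : set RM) : measurable A ->
  pushforward mu (translate a) A = mu A.
Proof.
move=> mA; apply/esym/lebesgue_measure_unique => //= _ [[l r]] _ <-.
rewrite /pushforward (_ : translate a @^-1` _ = `]l - a, r - a]%classic).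
  rewrite !lebesgue_measure_itv /= !lte_fin ltrD2r; case: ifP => // _.
  by rewrite -!EFinB; congr EFin; ring.
by apply/seteqP; split => x; rewrite /translate /= !in_itv /= ltrBlDr lerBrDr.
Qed.

Lemma ge0_integral_translate (a : R) (f : RM -> \bar R) :
  measurable_fun setT f -> (forall x, 0 <= f x)%E ->
  (\int[mu]_x f (x + a)%R = \int[mu]_x f x)%E.
Proof.
move=> mf f0.
have := @ge0_integral_pushforward _ _ _ _ _ (translate a) (measurable_translate a) mu setT f.
rewrite preimage_setT => <- //.
by apply: eq_measure_integral => A mA _; exact: lebesgue_measure_translate.
Qed.

Lemma integrable_translate (a : R) (f : RM -> R) :
  mu.-integrable setT (EFin \o f) ->
  mu.-integrable setT (EFin \o (fun x => f (x + a))).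
Proof.
move=> If.
have mf : measurable_fun setT f by apply/measurable_EFinP; exact: measurable_int If.
apply/integrableP; split.
  by apply/measurable_EFinP/(measurableT_comp mf); exact: measurable_translate.
move/integrableP : If => [_]; rewrite -(ge0_integral_translate a) //.
by apply: measurableT_comp => //; exact/measurable_EFinP.
Qed.

Lemma integral_translate (a : R) (f : RM -> R) :
  mu.-integrable setT (EFin \o f) ->
  (\int[mu]_x (f (x + a)%R)%:E = \int[mu]_x (f x)%:E)%E.
Proof.
move=> If; have Ia := integrable_translate a If.
have mf : measurable_fun setT f by apply/measurable_EFinP; exact: measurable_int If.
have := @integral_pushforward _ _ _ _ _ (translate a) (measurable_translate a) mu setT (EFin \o f).
rewrite preimage_setT => <- //; last exact/measurable_EFinP.
by apply: eq_measure_integral => A mA _; exact: lebesgue_measure_translate.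
Qed.

Lemma Rintegral_translate (a : R) (f : RM -> R) :
  mu.-integrable setT (EFin \o f) -> \int[mu]_x f (x + a) = \int[mu]_x f x.
Proof. by move=> If; congr fine; exact: integral_translate. Qed.

Lemma integrable_bounded_itv (f : RM -> R) (M a b : R) : measurable_fun setT f ->
  (forall x, `|f x| <= M * \1_`[a, b] x) -> mu.-integrable setT (EFin \o f).
Proof.
move=> mf fM.
have I1 := integrableZl measurableT M (integrable_indic_itv a b true false).
apply: le_integrable I1 => //; first exact/measurable_EFinP.
by move=> x _ /=; rewrite lee_fin (le_trans (fM x)) // ler_norm.
Qed.

Section Chord.
Variable A : R.
Hypothesis A0 : 0 <= A.

(** Half the chord of the disc of radius A at distance u from the centre; the
    square root of a negative number is 0, so S vanishes for A < |u|. *)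
Let S (u : R) := Num.sqrt (A ^+ 2 - u ^+ 2).

Lemma measurable_chord : measurable_fun setT (S : RM -> R).
Proof.
apply: measurableT_comp; first by apply: continuous_measurable_fun; exact: sqrt_continuous.
by apply: measurable_funB => //; exact: measurable_funX.
Qed.

Lemma chord_le u : 0 <= S u <= A.
Proof.
rewrite sqrtr_ge0 /= -[X in _ <= X](ger0_norm A0) -sqrtr_sqr ler_wsqrtr //.
by rewrite lerBlDr lerDl sqr_ge0.
Qed.

Lemma chord_eq0 u : A <= `|u| -> S u = 0.
Proof.
move=> Au; apply: ler0_sqrtr; rewrite subr_le0.
by rewrite -(real_normK (num_real u)) ler_sqr ?nnegrE.
Qed.

Lemma chord_supp u : `|S u| <= A * \1_`[- A, A] u.
Proof.
have /andP[S0 SA] := chord_le u; rewrite ger0_norm // indicE.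
have [uA|uA] := boolP (u \in `[- A, A]%classic); first by rewrite mulr1.
rewrite mulr0 chord_eq0 // leNgt; apply: contra uA => uA.
by rewrite inE /= in_itv /= -ler_norml ltW.
Qed.

Lemma integrable_chord : mu.-integrable setT (EFin \o (S : RM -> R)).
Proof. exact: integrable_bounded_itv measurable_chord chord_supp. Qed.

(** A^2 - u^2 = (A - |u|) (A + |u|) <= (2 h) (2 A). *)
Lemma chord_near (h u : R) : 0 <= h -> A - 2 * h <= `|u| -> S u <= 2 * Num.sqrt (h * A).
Proof.
move=> h0 uh; have [Au|uA] := leP A `|u|.
  by rewrite chord_eq0 // mulr_ge0 ?sqrtr_ge0.
have -> : 2 = Num.sqrt (2 ^+ 2) :> R by rewrite sqrtr_sqr ger0_norm.
rewrite -sqrtrM ?sqr_ge0 // ler_wsqrtr //.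
rewrite -(real_normK (num_real u)) subr_sqr.
have u0 := normr_ge0 u.
rewrite (_ : 2 ^+ 2 * (h * A) = (2 * h) * (2 * A)); last by ring.
by apply: ler_pM; lra.
Qed.

Lemma chord_concave (h u : R) : 0 <= h -> `|u| <= A - h -> S (u + h) + S (u - h) <= 2 * S u.
Proof.
move=> h0 uh.
have un := normr_ge0 u.
have [u1 u2] : - (A - h) <= u /\ u <= A - h by apply/andP; rewrite -ler_norml.
have p0 : 0 <= A ^+ 2 - (u + h) ^+ 2 by rewrite subr_sqr mulr_ge0 //; lra.
have q0 : 0 <= A ^+ 2 - (u - h) ^+ 2 by rewrite subr_sqr mulr_ge0 //; lra.
have r0 : 0 <= A ^+ 2 - u ^+ 2 by rewrite subr_sqr mulr_ge0 //; lra.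
have Sp : S (u + h) ^+ 2 = A ^+ 2 - (u + h) ^+ 2 by rewrite sqr_sqrtr.
have Sq : S (u - h) ^+ 2 = A ^+ 2 - (u - h) ^+ 2 by rewrite sqr_sqrtr.
have Sr : S u ^+ 2 = A ^+ 2 - u ^+ 2 by rewrite sqr_sqrtr.
have S1 := sqrtr_ge0 (A ^+ 2 - (u + h) ^+ 2); have S2 := sqrtr_ge0 (A ^+ 2 - (u - h) ^+ 2).
have S3 := sqrtr_ge0 (A ^+ 2 - u ^+ 2).
rewrite -ler_sqr ?nnegrE ?addr_ge0 ?mulr_ge0 //.
have := sqr_ge0 (S (u + h) - S (u - h)).
have := sqr_ge0 h.
nra.
Qed.

(** Where the second difference D is nonnegative, |D| = D. It can be negative
    only in the layers A - h < |u| < A + h, where each of S (u + h) and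
    S (u - h) is at most 2 sqrt (h A), so that |D| <= D + 2 (4 sqrt (h A)). *)
Lemma second_difference_bound (h u : R) : 0 <= h ->
  `|2 * S u - S (u + h) - S (u - h)| <=
  (2 * S u - S (u + h) - S (u - h)) +
  8 * Num.sqrt (h * A) * (\1_`[A - h, A + h] u + \1_`[- A - h, - A + h] u).
Proof.
move=> h0.
have s0 := sqrtr_ge0 (h * A).
have [uh|uh] := leP `|u| (A - h).
  rewrite ger0_norm; last by have := chord_concave h0 uh; lra.
  by rewrite lerDl mulr_ge0 // ?mulr_ge0 // addr_ge0 // indicE.
have n1 := ler_normD u h; have n2 := ler_normD u (- h).
have n3 := lerB_normD u h; have n4 := lerB_normD u (- h).
rewrite normrN in n2 n4; rewrite (ger0_norm h0) in n1 n2 n3 n4.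
have [uh2|uh2] := leP (A + h) `|u|.
  rewrite !chord_eq0; try lra.
  by rewrite mulr0 !subr0 normr0 add0r mulr_ge0 // ?mulr_ge0 // addr_ge0 // indicE.
have I1 : 1 <= \1_`[A - h, A + h] u + \1_`[- A - h, - A + h] u :> R.
  rewrite !indicE.
  have [u0|u0] := leP 0 u.
    rewrite (ger0_norm u0) in uh uh2.
    rewrite (mem_set (_ : `[A - h, A + h]%classic u)) ?lerDl //=.
    by rewrite in_itv /= !ltW.
  rewrite (ltr0_norm u0) in uh uh2.
  rewrite (mem_set (_ : `[- A - h, - A + h]%classic u)) ?lerDr //=.
  by rewrite in_itv /=; apply/andP; split; lra.
have c1 : S (u + h) <= 2 * Num.sqrt (h * A) by apply: chord_near => //; lra.
have c2 : S (u - h) <= 2 * Num.sqrt (h * A) by apply: chord_near => //; lra.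
have c3 : 8 * Num.sqrt (h * A) <= 8 * Num.sqrt (h * A) *
    (\1_`[A - h, A + h] u + \1_`[- A - h, - A + h] u) by rewrite ler_peMr // mulr_ge0.
have /andP[c4 _] := chord_le u.
rewrite ler_norml; apply/andP; split; lra.
Qed.

(** Decay k^(-3/2) of the Fourier integrals of S, for every bounded oscillation
    of antiperiod pi: cosine and sine are treated alike. *)
Lemma chord_fourier_bound (t : R -> R) (k : R) : 0 < k -> continuous t ->
  (forall x, `|t x| <= 1) -> (forall x, t (x + pi) = - t x) ->
  `|\int[mu]_u (t (k * u) * S u)| <= 8 * (pi / k) * Num.sqrt (pi / k * A).
Proof.
move=> k0 ct t1 tpi.
pose h := pi / k.
have h0 : 0 <= h by rewrite divr_ge0 ?pi_ge0 // ltW.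
have mt (b : R) : measurable_fun setT (fun u : RM => t (k * (u + b))).
  apply: (measurableT_comp (f := t)); first exact: continuous_measurable_fun.
  by apply: measurable_funM => //; exact: measurable_translate.
have kh (u : R) : k * (u + h) = k * u + pi by rewrite mulrDr /h mulrCA divff ?mulr1 // gt_eqF.
have tN (x : R) : t (x - pi) = - t x by rewrite -[in RHS](subrK pi x) tpi opprK.
have IS (b : R) : mu.-integrable setT (EFin \o (fun u => S (u + b))).
  exact: integrable_translate integrable_chord.
pose F (u : R) := t (k * u) * S u.
have mF0 : measurable_fun setT (fun u : RM => t (k * u)).
  by have := mt 0; under eq_fun do rewrite addr0.
have dom (f g : RM -> R) : measurable_fun setT f -> (forall x, `|f x| <= 1) ->
   mu.-integrable setT (EFin \o g) -> mu.-integrable setT (EFin \o (fun x => f x * g x)).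
  move=> mf f1 Ig.
  have mg : measurable_fun setT g by apply/measurable_EFinP; exact: measurable_int Ig.
  apply: le_integrable Ig => //; first by apply/measurable_EFinP; exact: measurable_funM.
  by move=> x _; rewrite /= lee_fin normrM ler_piMl.
have IF : mu.-integrable setT (EFin \o (F : RM -> R)).
  by apply: dom => //; exact: integrable_chord.
pose I := \int[mu]_u F u.
(* a shift of S by a half period changes the sign of the integral *)
have shift_int (b : R) : (forall u, F (u + b) = - (t (k * u) * S (u + b))) ->
   mu.-integrable setT (EFin \o (fun u => t (k * u) * S (u + b))) /\
   \int[mu]_u (t (k * u) * S (u + b)) = - I.
  move=> HF; have Ib : mu.-integrable setT (EFin \o (fun u => t (k * u) * S (u + b))).
    by apply: dom => //; exact: IS.
  split => //; rewrite /I -(Rintegral_translate b IF).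
  under [in RHS]eq_Rintegral do rewrite HF -mulN1r.
  by rewrite RintegralZl // mulN1r opprK.
have [I1 E1] : mu.-integrable setT (EFin \o (fun u => t (k * u) * S (u + h))) /\
   \int[mu]_u (t (k * u) * S (u + h)) = - I.
  by apply: shift_int => u; rewrite /F kh tpi mulNr.
have [I2 E2] : mu.-integrable setT (EFin \o (fun u => t (k * u) * S (u - h))) /\
   \int[mu]_u (t (k * u) * S (u - h)) = - I.
  apply: shift_int => u; rewrite /F.
  have -> : k * (u - h) = k * u - pi by have := kh (u - h); rewrite subrK; lra.
  by rewrite tN mulNr.
pose D (u : R) := 2 * S u - S (u + h) - S (u - h).
have I2S := integrableZl measurableT 2 integrable_chord.
have ID : mu.-integrable setT (EFin \o (D : RM -> R)).
  exact: (integrableB measurableT (integrableB measurableT I2S (IS h)) (IS (- h))).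
have ED : \int[mu]_u D u = 0.
  rewrite /D RintegralB //; last exact: (integrableB measurableT I2S (IS h)).
  rewrite RintegralB // RintegralZl //; last exact: integrable_chord.
  rewrite !(Rintegral_translate _ integrable_chord); ring.
have E4 : 4 * I = \int[mu]_u (t (k * u) * D u).
  have -> : (fun u : RM => t (k * u) * D u) =
     (fun u => 2 * F u - t (k * u) * S (u + h) - t (k * u) * S (u - h)).
    by apply/funext => u; rewrite /D /F; ring.
  have I2F := integrableZl measurableT 2 IF.
  rewrite RintegralB //; last exact: (integrableB measurableT I2F I1).
  by rewrite RintegralB // RintegralZl // E1 E2 -/I; ring.
have ITD := dom _ _ mF0 (fun x => t1 _) ID.
have s0 := sqrtr_ge0 (h * A).
have : `|4 * I| <= 4 * (8 * h * Num.sqrt (h * A)).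
  rewrite E4; apply: le_trans (le_normr_Rintegral measurableT ITD) _.
  pose c := 8 * Num.sqrt (h * A).
  have J1 := integrable_indic_itv (A - h) (A + h) true false.
  have J2 := integrable_indic_itv (- A - h) (- A + h) true false.
  have J := integrableD measurableT J1 J2.
  have cJ := integrableZl measurableT c J.
  have DJ := integrableD measurableT ID cJ.
  (* the integral of D is 0, so only the two layers of length 2 h contribute *)
  apply: le_trans (_ : \int[mu]_u (D u + c * (\1_`[A - h, A + h] u + \1_`[- A - h, - A + h] u)) <= _).
    apply: le_Rintegral => //; first exact: integrable_norm ITD.
    move=> u _; apply: le_trans (second_difference_bound u h0).
    by rewrite normrM ler_piMl.
  rewrite RintegralD // ED add0r RintegralZl // RintegralD //.
  rewrite /Rintegral !integral_indic //= !setIT !lebesgue_measure_itv /=.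
  have lenE (l : R) : fine (if (l - h)%:E < (l + h)%:E then (l + h)%:E - (l - h)%:E else 0%:E)%E <= 2 * h.
    by case: ifP => _ /=; lra.
  have := lenE A; have := lenE (- A) => /= L1 L2.
  rewrite (_ : 4 * (8 * h * _) = c * (2 * h + 2 * h)); last by rewrite /c; ring.
  by rewrite ler_wpM2l ?mulr_ge0 // lerD.
by rewrite normrM ger0_norm // ler_pM2l.
Qed.

End Chord.
End Shift.

(** * The Fourier transform of a disc *)

Section Disc.
Variable R : realType.
Notation mu := (@lebesgue_measure R).
Notation RM := (measurableTypeR R).

Definition disc (a : R) : set (RM * RM) := [set x | dot2 x x <= a ^+ 2].

Lemma measurable_dot2 d (T : measurableType d) (f g : T -> RM * RM) :
  measurable_fun setT f -> measurable_fun setT g ->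
  measurable_fun setT (fun x => dot2 (f x) (g x) : RM).
Proof.
move=> mf mg; apply: measurable_funD; apply: measurable_funM;
  by [exact: (measurableT_comp measurable_fst)|exact: (measurableT_comp measurable_snd)].
Qed.

Lemma measurable_disc (a : R) : measurable (disc a).
Proof.
rewrite (_ : disc a = (fun x => dot2 x x : RM) @^-1` `]-oo, a ^+ 2]%classic); last first.
  by apply/seteqP; split => x; rewrite /= in_itv.
rewrite -[X in measurable X]setTI.
by apply: measurable_dot2 => //; exact: measurable_itv.
Qed.

Lemma measurable_indic_disc (a : R) d (T : measurableType d) (g : T -> RM * RM) :
  measurable_fun setT g -> measurable_fun setT (fun x => \1_(disc a) (g x) : R).
Proof.
move=> mg; apply: (@measurableT_comp _ _ _ _ _ _ (\1_(disc a) : RM * RM -> R) _ g) => //.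
by apply: measurable_indic; exact: measurable_disc.
Qed.

Lemma disc_coord_le (a : R) x : 0 <= a -> disc a x -> `|x.1| <= a /\ `|x.2| <= a.
Proof.
rewrite /disc /dot2 /= -!expr2 => a0 xa.
have q1 := sqr_ge0 x.1; have q2 := sqr_ge0 x.2.
by split; rewrite -ler_sqr ?nnegrE // real_normK ?num_real //; lra.
Qed.

Lemma integrable_box (h : RM * RM -> R) (B : R) : measurable_fun setT h ->
  (forall p, `|h p| <= \1_`[- B, B] p.1 * \1_`[- B, B] p.2) ->
  (lebesgue2 R).-integrable setT (EFin \o h).
Proof.
move=> mh hB.
have J := integrable_indic_itv (- B) B true false.
apply: le_integrable (integrable_prodT J J) => //; first exact/measurable_EFinP.
move=> p _; rewrite /= lee_fin; apply: le_trans (hB p) _.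
by rewrite ger0_norm // mulr_ge0 // indicE.
Qed.

Lemma box_bound (a B : R) (p q : RM * RM) (s : R) : 0 <= a ->
  `|s| <= 1 -> (disc a p -> `|q.1| <= B /\ `|q.2| <= B) ->
  `|\1_(disc a) p * s| <= \1_`[- B, B] q.1 * \1_`[- B, B] q.2.
Proof.
move=> a0 s1 pq; rewrite normrM !indicE.
have [pD|pD] := boolP (p \in disc a); last by rewrite normr0 mul0r mulr_ge0.
move: pD; rewrite inE => /pq [q1 q2].
rewrite !mem_set /= ?in_itv /= -?ler_norml //.
by rewrite normr1 !mul1r.
Qed.

Section Transform.
Variables (a : R) (t : R -> R).
Hypotheses (a0 : 0 < a) (ct : continuous t) (t1 : forall x, `|t x| <= 1).
Hypothesis tpi : forall x, t (x + pi) = - t x.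

Let H (xi p : RM * RM) : R := \1_(disc a) p * t (dot2 p xi).

(** The real or the imaginary part of the Fourier transform of the disc, for
    t x = cos (- x) or t x = sin (- x). *)
Definition disc_transform (xi : R * R) : R :=
  \int[lebesgue2 R]_(x in disc a) t (dot2 x xi).

Lemma disc_transformE xi : disc_transform xi = \int[lebesgue2 R]_x H xi x.
Proof.
rewrite /disc_transform Rintegral_mkcond; congr Rintegral; apply/funext => x.
by rewrite patchE /H indicE; case: (x \in disc a); rewrite ?mul1r ?mul0r.
Qed.

Let mt d (T : measurableType d) (f : T -> RM) : measurable_fun setT f ->
  measurable_fun setT (fun x => t (f x)).
Proof.
move=> mf; apply: (@measurableT_comp _ _ _ _ _ _ (t : RM -> R) _ f) => //.
exact: continuous_measurable_fun.
Qed.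

Lemma integrable_H xi : (lebesgue2 R).-integrable setT (EFin \o H xi).
Proof.
apply: (@integrable_box _ a).
  apply: measurable_funM; first exact: measurable_indic_disc.
  by apply: mt; exact: measurable_dot2.
by move=> p; apply: box_bound; [exact: ltW| |exact/disc_coord_le/ltW].
Qed.

Lemma disc_transform_le xi : `|disc_transform xi| <= (2 * a) ^+ 2.
Proof.
rewrite disc_transformE.
have I := integrable_H xi.
have J := integrable_indic_itv (- a) a true false.
apply: le_trans (le_normr_Rintegral measurableT I) _.
apply: le_trans (_ : \int[lebesgue2 R]_p (\1_`[- a, a] p.1 * \1_`[- a, a] p.2) <= _).
  apply: le_Rintegral => //; [exact: integrable_norm I|exact: integrable_prodT|].
  by move=> p _; apply: box_bound; [exact: ltW| |exact/disc_coord_le/ltW].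
rewrite Rintegral_prodT // /Rintegral !integral_indic //= !setIT !lebesgue_measure_itv /=.
by rewrite lte_fin gtrN // expr2 le_eqVlt; apply/orP; left; apply/eqP; rewrite /=; ring.
Qed.

Lemma disc_transform_swap (x y : R) : disc_transform (x, y) = disc_transform (y, x).
Proof.
rewrite !disc_transformE; congr fine.
rewrite -(integral21_prod_meas1 (integrable_H (x, y))).
rewrite -(integral12_prod_meas1 (integrable_H (y, x))).
apply: eq_integral => u _; rewrite /fubini_G /fubini_F /=.
apply: eq_integral => v _; rewrite /H /dot2 /= addrC.
congr (_ * _)%:E; rewrite !indicE; congr (nat_of_bool _)%:R.
by apply/idP/idP; rewrite !inE /disc /dot2 /= addrC.
Qed.

(** With q = 1 + c^2, the condition (u - c y)^2 + y^2 <= a^2 reads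
    (q y - u c)^2 <= q a^2 - u^2: the sections of the sheared disc are chords of
    a disc of radius a sqrt q, shortened by the factor q. *)
Lemma sheared_section (c u : R) :
  (\int[mu]_y (\1_(disc a) (u - c * y, y))%:E =
   (2 / (1 + c ^+ 2) * Num.sqrt ((a * Num.sqrt (1 + c ^+ 2)) ^+ 2 - u ^+ 2))%:E)%E.
Proof.
have q0 : 0 < 1 + c ^+ 2 by rewrite ltr_pwDl // sqr_ge0.
have qn0 : 1 + c ^+ 2 != 0 by rewrite gt_eqF.
rewrite exprMn sqr_sqrtr ?ltW //.
set q := 1 + c ^+ 2 in q0 qn0 *; set d := a ^+ 2 * q - u ^+ 2.
have iff_y (y : R) : (dot2 (u - c * y, y) (u - c * y, y) <= a ^+ 2) = ((q * y - u * c) ^+ 2 <= d).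
  rewrite -subr_ge0 -[RHS]subr_ge0 -(pmulr_rge0 _ q0).
  by congr (0 <= _); rewrite /dot2 /d /q /=; ring.
have [d0|d0] := ltP d 0.
  rewrite ltr0_sqrtr // mulr0.
  apply: integral0_eq => y _; rewrite indicE memNset //= /disc /= iff_y.
  by apply/negP; rewrite -ltNge (lt_le_trans d0) // sqr_ge0.
set s := Num.sqrt d.
have s0 : 0 <= s by exact: sqrtr_ge0.
transitivity (\int[mu]_y (\1_`[((u * c - s) / q)%R, ((u * c + s) / q)%R] y)%:E)%E.
  apply: eq_integral => y _; rewrite !indicE; congr (nat_of_bool _)%:R%:E.
  have Y : (disc a (u - c * y, y)) = (y \in `[(u * c - s) / q, (u * c + s) / q]) :> Prop.
    rewrite /disc /= iff_y in_itv /= ler_pdivrMr // ler_pdivlMr //.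
    rewrite -(real_normK (num_real (q * y - u * c))) -(sqr_sqrtr d0) -/s.
    rewrite ler_sqr ?nnegrE // ler_norml lerBrDr lerBlDr [y * q]mulrC.
    by rewrite (addrC (- s)) (addrC s).
  by apply/idP/idP; rewrite !inE /= Y.
rewrite integral_indic //= setIT lebesgue_measure_itv /= lte_fin.
rewrite ltr_pM2r ?invr_gt0 //; case: ifP => h.
  by rewrite -EFinB; congr EFin; field.
have -> : s = 0 by apply/eqP; rewrite eq_le s0 andbT; move/negbT: h; rewrite -leNgt; lra.
by rewrite mulr0.
Qed.

(** The shear (x, y) |-> (u, y) with x = u - c y and c = l / k turns the phase
    k x + l y into k u. *)
Lemma disc_transform_shear (k l : R) : k != 0 ->
  disc_transform (k, l) =
  2 / (1 + (l / k) ^+ 2) *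
  \int[mu]_u (t (k * u) * Num.sqrt ((a * Num.sqrt (1 + (l / k) ^+ 2)) ^+ 2 - u ^+ 2)).
Proof.
move=> k0; set c := l / k.
pose K (p : RM * RM) : R := \1_(disc a) (p.1 - c * p.2, p.2) * t (k * p.1).
have IK : (lebesgue2 R).-integrable setT (EFin \o K).
  apply: (@integrable_box _ (a + `|c| * a)).
    apply: measurable_funM.
      apply: measurable_indic_disc; apply: measurable_fun_pair => //.
      by apply: measurable_funB => //; apply: measurable_funM.
    have mk : measurable_fun setT (fun p : RM * RM => (k * p.1 : RM)).
      by apply: measurable_funM => //; exact: measurable_fst.
    exact: mt mk.
  move=> p; apply: box_bound => //; first exact: ltW.
  move=> /(disc_coord_le (ltW a0)) /= [h1 h2].
  have c0 := normr_ge0 c.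
  have ca : `|c * p.2| <= `|c| * a by rewrite normrM ler_wpM2l.
  split.
    by rewrite -[p.1](subrK (c * p.2)) (le_trans (ler_normD _ _)) // lerD.
  by rewrite (le_trans h2) // lerDl mulr_ge0 // ltW.
rewrite disc_transformE /Rintegral.
rewrite -(integral21_prod_meas1 (integrable_H (k, l))).
transitivity (fine (\int[mu]_y fubini_G mu (EFin \o K) y)%E).
  congr fine; apply: eq_integral => y _; rewrite /fubini_G /=.
  have Iy : mu.-integrable setT (EFin \o (fun x : RM => H (k, l) (x, y))).
    apply: (@integrable_bounded_itv _ _ 1 (- a) a).
      apply: measurable_funM.
        apply: measurable_indic_disc; exact: measurable_pair2.
      by apply: mt; apply: measurable_dot2 => //; exact: measurable_pair2.
    move=> x; rewrite mul1r.
    apply: le_trans (_ : \1_`[- a, a] x * \1_`[- a, a] y <= _).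
      exact: (@box_bound _ _ (x, y) (x, y) _ (ltW a0) (t1 _) (disc_coord_le (ltW a0))).
    by rewrite ler_piMr // ?indicE // lern1 leq_b1.
  rewrite -(integral_translate (- (c * y)) Iy).
  apply: eq_integral => u _; rewrite /H /K /dot2 /=.
  by congr (_ * t _)%:E; rewrite /c; field.
rewrite (integral21_prod_meas1 IK) -(integral12_prod_meas1 IK).
set A := a * _; set q := 2 / _.
have A0 : 0 <= A by rewrite mulr_ge0 ?sqrtr_ge0 // ltW.
have q0 : 0 <= q by rewrite divr_ge0 // addr_ge0 // sqr_ge0.
have mtk : measurable_fun setT (fun u : RM => t (k * u)) by apply: mt; apply: measurable_funM.
have IS : mu.-integrable setT (EFin \o (fun u : RM => t (k * u) * Num.sqrt (A ^+ 2 - u ^+ 2))).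
  apply: le_integrable (integrable_chord A0) => //.
    by apply/measurable_EFinP; apply: measurable_funM => //; exact: measurable_chord.
  by move=> u _; rewrite /= lee_fin normrM ler_piMl.
rewrite -/(Rintegral _ _ _) -RintegralZl //; congr fine.
apply: eq_integral => u _; rewrite /fubini_F /= /K /=.
under eq_integral => y _ do rewrite mulrC EFinM.
rewrite integralZl //; last first.
  apply: (@integrable_bounded_itv _ _ 1 (- a) a).
    apply: measurable_indic_disc; apply: measurable_fun_pair => //.
    by apply: measurable_funB => //; apply: measurable_funM.
  move=> y; rewrite mul1r.
  have := @box_bound a a (u - c * y, y) (0, y) 1 (ltW a0).
  rewrite mulr1 normr1 => /(_ (lexx _)) h; apply: le_trans (h _) _.
    move=> /(disc_coord_le (ltW a0)) [_ /= ->]; rewrite normr0; split => //; exact: ltW.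
  by rewrite ler_piMl // ?indicE // lern1 leq_b1.
by rewrite sheared_section -EFinM; congr EFin; rewrite -/A -/q; ring.
Qed.

End Transform.
End Disc.

(** * Decay and measurability of the transform *)

Section Decay.
Variable R : realType.
Notation mu := (@lebesgue_measure R).
Notation RM := (measurableTypeR R).
Variables (a : R) (t : R -> R).
Hypotheses (a0 : 0 < a) (ct : continuous t) (t1 : forall x, `|t x| <= 1).
Hypothesis tpi : forall x, t (x + pi) = - t x.

Lemma chord_fourier_bound_neq0 (A k : R) : 0 <= A -> k != 0 ->
  `|\int[mu]_u (t (k * u) * Num.sqrt (A ^+ 2 - u ^+ 2))| <=
    8 * (pi / `|k|) * Num.sqrt (pi / `|k| * A).
Proof.
move=> A0 k0; have [kp|kn] := leP 0 k.
  rewrite (ger0_norm kp); apply: (chord_fourier_bound A0 _ ct t1 tpi).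
  by rewrite lt_neqAle eq_sym k0.
rewrite (ltr0_norm kn).
have nk0 : 0 < - k by rewrite oppr_gt0.
have ct' : continuous (fun x => t (- x)).
  by move=> x; apply: (continuous_comp (f := -%R)); [exact: continuousN|exact: ct].
have tpi' x : t (- (x + pi)) = - t (- x).
  by rewrite -[in RHS](subrK pi (- x)) tpi opprK opprD.
have := chord_fourier_bound A0 nk0 ct' (fun x => t1 (- x)) tpi'.
by under eq_Rintegral do rewrite mulNr opprK.
Qed.

(** For |l| <= |k| the shear satisfies c^2 <= 1, so the factor 2 / (1 + c^2) is
    at most 2 and the radius A at most 2 a; then 512 = 2^2 8^2 2. *)
Lemma disc_transform_sqr_le (k l : R) : k != 0 -> `|l| <= `|k| ->
  disc_transform a t (k, l) ^+ 2 <= 512 * a * pi ^+ 3 / `|k| ^+ 3.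
Proof.
move=> k0 lk.
have nk : 0 < `|k| by rewrite normr_gt0.
have c1 : (l / k) ^+ 2 <= 1.
  by rewrite -real_normK ?num_real // expr_le1 // normf_div ler_pdivrMr // mul1r.
have c0 := sqr_ge0 (l / k).
have s2 : Num.sqrt (1 + (l / k) ^+ 2) <= 2.
  have -> : 2 = Num.sqrt (2 ^+ 2) :> R by rewrite sqrtr_sqr ger0_norm.
  by rewrite ler_wsqrtr //; lra.
rewrite (disc_transform_shear a0 ct t1 l k0).
set q := 2 / _; set A := a * _; set I := Rintegral _ _ _.
have A0 : 0 <= A by rewrite mulr_ge0 ?sqrtr_ge0 // ltW.
have A2 : A <= 2 * a by rewrite /A [2 * a]mulrC ler_pM2l.
have q0 : 0 <= q by rewrite divr_ge0 // addr_ge0.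
have q2 : q <= 2 by rewrite /q ler_pdivrMr ?ltr_pwDl //; lra.
have p0 : 0 < pi / `|k| :> R by rewrite divr_gt0 ?pi_gt0.
have IB : `|I| <= 8 * (pi / `|k|) * Num.sqrt (pi / `|k| * A) := chord_fourier_bound_neq0 A0 k0.
have I2 : I ^+ 2 <= 64 * (pi / `|k|) ^+ 2 * (pi / `|k| * A).
  have -> : 64 * (pi / `|k|) ^+ 2 * (pi / `|k| * A) = (8 * (pi / `|k|) * Num.sqrt (pi / `|k| * A)) ^+ 2.
    rewrite [in RHS]exprMn sqr_sqrtr; first by ring.
    exact: mulr_ge0 (ltW p0) A0.
  rewrite -real_normK ?num_real // ler_sqr ?nnegrE // mulr_ge0 ?sqrtr_ge0 //.
  exact: mulr_ge0 _ (ltW p0).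
rewrite exprMn.
apply: le_trans (_ : 4 * (64 * (pi / `|k|) ^+ 2 * (pi / `|k| * (2 * a))) <= _).
  apply: ler_pM; rewrite ?sqr_ge0 //.
    have -> : 4 = 2 ^+ 2 :> R by ring.
    by rewrite ler_sqr ?nnegrE.
  apply: le_trans I2 _; apply: ler_wpM2l; last by rewrite (ler_pM2l p0).
  by rewrite mulr_ge0 // sqr_ge0.
rewrite le_eqVlt; apply/orP; left; apply/eqP; field.
by rewrite normr_eq0.
Qed.

(** The first summand controls frequencies with max >= 1, the second one the
    others; the factors 8 come from (1 + max)^3 <= 8 max^3 and <= 8. *)
Definition decay_const : R := 8 * (512 * a * pi ^+ 3) + 8 * (2 * a) ^+ 4.

Lemma disc_transform_decay_ord (k l : R) : `|l| <= `|k| ->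
  disc_transform a t (k, l) ^+ 2 <= decay_const / (1 + `|k|) ^+ 3.
Proof.
move=> lk; have nk := normr_ge0 k.
have K0 : 0 < (1 + `|k|) ^+ 3 by rewrite exprn_gt0 // ltr_pwDl.
have c1 : 0 <= 8 * (512 * a * pi ^+ 3).
  apply: mulr_ge0; first exact: ler0n.
  apply: mulr_ge0; last exact: exprn_ge0 (pi_ge0 R).
  by apply: mulr_ge0; [exact: ler0n|exact: ltW].
have c2 : 0 <= 8 * (2 * a) ^+ 4.
  by apply: mulr_ge0; [exact: ler0n|rewrite exprn_even_ge0].
rewrite ler_pdivlMr //.
have [k1|k1] := leP 1 `|k|.
  have kn0 : k != 0 by rewrite -normr_gt0 (lt_le_trans ltr01).
  have k3 : 0 < `|k| ^+ 3 by rewrite exprn_gt0 // normr_gt0.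
  have K8 : (1 + `|k|) ^+ 3 <= 8 * `|k| ^+ 3.
    have -> : 8 * `|k| ^+ 3 = (2 * `|k|) ^+ 3 by ring.
    by apply: lerXn2r; rewrite ?nnegrE; lra.
  apply: le_trans (_ : (512 * a * pi ^+ 3 / `|k| ^+ 3) * (8 * `|k| ^+ 3) <= _).
    exact: (ler_pM (sqr_ge0 _) (ltW K0) (disc_transform_sqr_le kn0 lk) K8).
  have -> : (512 * a * pi ^+ 3 / `|k| ^+ 3) * (8 * `|k| ^+ 3) = 8 * (512 * a * pi ^+ 3).
    set c := 512 * _ * _; by field; rewrite normr_eq0.
  by rewrite lerDl.
have K8 : (1 + `|k|) ^+ 3 <= 8.
  have -> : 8 = 2 ^+ 3 :> R by ring.
  by apply: lerXn2r; rewrite ?nnegrE; lra.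
apply: le_trans (_ : (2 * a) ^+ 4 * 8 <= _); last by rewrite mulrC lerDr.
have G4 : disc_transform a t (k, l) ^+ 2 <= (2 * a) ^+ 4.
  have -> : (2 * a) ^+ 4 = ((2 * a) ^+ 2) ^+ 2 by ring.
  rewrite -real_normK ?num_real // ler_sqr ?nnegrE ?sqr_ge0 //.
  exact: disc_transform_le.
exact: (ler_pM (sqr_ge0 _) (ltW K0) G4 K8).
Qed.

Lemma disc_transform_decay (xi : R * R) :
  disc_transform a t xi ^+ 2 <= decay_const / (1 + Num.max `|xi.1| `|xi.2|) ^+ 3.
Proof.
case: xi => k l /=; have [lk|kl] := leP `|l| `|k|; first exact: disc_transform_decay_ord.
by rewrite disc_transform_swap //; apply: disc_transform_decay_ord; exact: ltW.
Qed.

(** Adding 1 to t makes the integrand nonnegative, so that Tonelli gives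
    measurability in xi of the iterated integral. *)
Lemma measurable_disc_transform :
  measurable_fun setT (fun xi : RM * RM => disc_transform a t xi).
Proof.
have mt d (T : measurableType d) (f : T -> RM) : measurable_fun setT f ->
  measurable_fun setT (fun x => t (f x)).
  move=> mf; apply: (@measurableT_comp _ _ _ _ _ _ (t : RM -> R) _ f) => //.
  exact: continuous_measurable_fun.
pose h (xi x : RM * RM) : R := \1_(disc a) x * (1 + t (dot2 x xi)).
have h0 xi x : 0 <= h xi x.
  rewrite mulr_ge0 ?indicE //.
  by have := t1 (dot2 x xi); rewrite ler_norml => /andP[? _]; lra.
have mh d (T : measurableType d) (f g : T -> RM * RM) : measurable_fun setT f ->
    measurable_fun setT g -> measurable_fun setT (fun p => h (f p) (g p)).
  move=> mf mg; apply: measurable_funM; first exact: measurable_indic_disc.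
  by apply: measurable_funD => //; apply: mt; exact: measurable_dot2.
pose h3 (p : ((RM * RM) * RM) * RM) : \bar R := (h p.1.1 (p.1.2, p.2))%:E.
pose F3 := fubini_F mu h3.
have mF3 : measurable_fun setT F3.
  apply: measurable_fun_fubini_tonelli_F.
    apply/measurable_EFinP; apply: mh; first by apply: measurableT_comp.
    by apply: measurable_fun_pair => //; exact: measurableT_comp.
  by move=> p; rewrite lee_fin.
have F30 p : (0 <= F3 p)%E by apply: integral_ge0 => y _; rewrite lee_fin.
have mF2 : measurable_fun setT (fubini_F mu F3) by exact: measurable_fun_fubini_tonelli_F.
have Idisc : (lebesgue2 R).-integrable setT (EFin \o (\1_(disc a) : RM * RM -> R)).
  apply: (@integrable_box _ _ a).
    by apply: measurable_indic; exact: measurable_disc.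
  move=> p; have := @box_bound _ a a p p 1 (ltW a0).
  by rewrite mulr1 normr1; apply => //; exact/disc_coord_le/ltW.
have E (xi : RM * RM) : disc_transform a t xi =
    fine (fubini_F mu F3 xi) - \int[lebesgue2 R]_x \1_(disc a) x.
  have -> : fine (fubini_F mu F3 xi) = \int[lebesgue2 R]_x h xi x.
    congr fine; rewrite fubini_tonelli1 //.
    - by apply/measurable_EFinP; apply: mh.
    - by move=> x; rewrite lee_fin.
  have IH := integrable_H a0 ct t1 xi.
  rewrite disc_transformE.
  rewrite (_ : (fun x => h xi x) = (fun x => \1_(disc a) x + \1_(disc a) x * t (dot2 x xi))); last first.
    by apply/funext => x; rewrite /h mulrDr mulr1.
  by rewrite RintegralD // [X in _ = X - _]addrC addrK.
under eq_fun do rewrite E.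
by apply: measurable_funB => //; exact: measurableT_comp.
Qed.

End Decay.

(** * Sobolev regularity of the disc *)

Section Lfun2.
Context (d : measure_display) (T : measurableType d) (R : realType)
  (mu : {measure set T -> \bar R}).

Lemma Lfun2_of_integrable_sqr (f : T -> R) : measurable_fun setT f ->
  mu.-integrable setT (EFin \o (fun x => f x ^+ 2)) -> f \in Lfun mu 2%:E.
Proof.
move=> mf If; rewrite inE; apply/andP; split; rewrite inE //=.
rewrite /finite_norm unlock poweR_lty //.
have /integrableP[_] := If; congr (_ < _)%E.
by apply: eq_integral => x _ /=; rewrite powR_mulrn // normrX.
Qed.

Lemma Lfun2_dominated (f g : T -> R) : measurable_fun setT f ->
  mu.-integrable setT (EFin \o g) -> (forall x, f x ^+ 2 <= g x) -> f \in Lfun mu 2%:E.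
Proof.
move=> mf Ig fg; apply: Lfun2_of_integrable_sqr => //.
apply: le_integrable Ig => //; first by apply/measurable_EFinP; exact: measurable_funX.
by move=> x _; rewrite /= lee_fin ger0_norm ?sqr_ge0 // (le_trans (fg x)) // ler_norm.
Qed.

End Lfun2.

Section Weight.
Variable R : realType.
Notation mu := (@lebesgue_measure R).
Notation RM := (measurableTypeR R).

(** The squared transform decays with exponent 3, of which the Sobolev weight of
    order 3/8 consumes 3/4. The remaining 9/4 is split evenly between the two
    variables, and 9/8 > 1 makes each factor integrable. *)
Definition weight (x : R) : R := (1 + `|x|) `^ (- (9 / 8)).

Lemma continuous_weight : continuous weight.
Proof.
move=> x.
have x1 : 0 < 1 + `|x| by rewrite ltr_pwDl.
apply: (@continuous_comp _ _ _ (fun x : R => 1 + `|x|) (fun y : R => y `^ (- (9 / 8)))).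
  by apply: cvgD; [exact: cvg_cst|exact: norm_continuous].
apply/differentiable_continuous/derivable1_diffP.
by apply: derivable_powR; rewrite in_itv /= x1.
Qed.

Lemma integrable_weight : mu.-integrable setT (EFin \o (weight : RM -> R)).
Proof.
have w0 x : 0 <= weight x by exact: powR_ge0.
apply/integrableP; split.
  by apply/measurable_EFinP; apply: continuous_measurable_fun; exact: continuous_weight.
under eq_integral do rewrite /= ger0_norm //.
rewrite ge0_symfun_integralT //; [|exact: continuous_weight|by move=> x; rewrite /weight /= normrN].
rewrite -set_itvcy.
pose f (x : R) : R := (1 + x) `^ (- (9 / 8)).
pose F (x : R) : R := - 8 * (1 + x) `^ (- (1 / 8)).
rewrite (@eq_integral _ _ _ _ _ (fun x : RM => (f x)%:E)); last first.
  by move=> x; rewrite inE /= in_itv /= andbT => x0; rewrite /weight ger0_norm.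
have dF (x : R) : -1 < x -> is_derive x (1:R) F (f x).
  move=> x1; have x10 : 0 < 1 + x by lra.
  have d1 : is_derive x (1:R) (fun y : R => 1 + y) 1.
    by have := is_deriveD (is_derive_cst (1:R) x (1:R)) (is_derive_id x (1:R)); rewrite add0r.
  have E2 : - (1 / 8) - 1 = - (9 / 8) :> R by field.
  have D := is_deriveZ (-8) (is_derive1_comp (is_derive1_powR (- (1/8)) x10) d1).
  apply: is_derive_eq D _; rewrite E2 /f /GRing.scale /=.
  by set y := powR _ _; field.
have cF (x : R) : -1 < x -> {for x, continuous F}.
  move=> x1; apply/differentiable_continuous/derivable1_diffP.
  exact: (@ex_derive _ _ _ _ _ _ _ (dF x x1)).
rewrite (@ge0_continuous_FTC2y _ f F 0 0).
- by rewrite -EFinB -EFinM ltry.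
- by move=> x _; exact: powR_ge0.
- apply: continuous_in_subspaceT => x; rewrite inE /= in_itv /= andbT => x0.
  have x10 : 0 < 1 + x by rewrite ltr_pwDl.
  apply: (@continuous_comp _ _ _ (fun x : R => 1 + x) (fun y : R => y `^ (- (9 / 8)))).
    by apply: cvgD; [exact: cvg_cst|exact: cvg_id].
  apply/differentiable_continuous/derivable1_diffP.
  by apply: derivable_powR; rewrite in_itv /= x10.
- apply/cvgrPdist_lt => e e0.
  have e8 : 0 < 8 / e by rewrite divr_gt0.
  near=> x.
  have x0 : 0 < x by near: x; exact: nbhs_pinfty_gt.
  have xe : (8 / e) `^ 8 < 1 + x.
    by rewrite (@lt_trans _ _ x) // ?ltrDr //; near: x; apply: nbhs_pinfty_gt; exact: num_real.
  have p8 : 8 / e < (1 + x) `^ (1 / 8).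
    have -> : 8 / e = ((8 / e) `^ 8) `^ (1 / 8).
      by rewrite -powRrM mul1r divff // powRr1 // ltW.
    by apply: gt0_ltr_powR => //; rewrite nnegrE ?powR_ge0 //; lra.
  have p0 : 0 < (1 + x) `^ (1 / 8) by exact: lt_trans p8.
  rewrite sub0r /F mulNr opprK powRN ger0_norm ?divr_ge0 // ?(ltW p0) //.
  by rewrite ltr_pdivrMr // mulrC -ltr_pdivrMr.
- move=> x x0; apply: (@ex_derive _ _ _ _ _ _ _ (dF x _)); lra.
- by apply: cvg_at_right_filter; apply: cF; lra.
- move=> x; rewrite in_itv /= andbT => x0; rewrite derive1E.
  by apply: (@derive_val _ _ _ _ _ _ _ (dF x _)); lra.
Unshelve. all: by end_near.
Qed.

(** With B = 1 + max the Sobolev weight is at most 2 B^(3/4), and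
    B^(3/4 - 3) = (B^(- 9/8))^2 is at most the product of the two weights. *)
Lemma weight_bound (C G : R) (xi : R * R) :
  0 <= C -> G <= C / (1 + Num.max `|xi.1| `|xi.2|) ^+ 3 ->
  ((1 + dot2 xi xi) `^ (3 / 8 / 2)) ^+ 2 * G <= 2 * C * (weight xi.1 * weight xi.2).
Proof.
move=> C0 GC; set M := Num.max _ _ in GC.
have M1 : `|xi.1| <= M by rewrite /M le_max lexx.
have M2 : `|xi.2| <= M by rewrite /M le_max lexx orbT.
have M0 : 0 <= M := le_trans (normr_ge0 _) M1.
set B := 1 + M in GC.
have B0 : 0 < B by rewrite ltr_pwDl.
have dotB : 1 + dot2 xi xi <= 2 * B `^ 2.
  rewrite powR_mulrn ?ltW // /dot2 -!expr2.
  have s1 : xi.1 ^+ 2 <= M ^+ 2 by rewrite -real_normK ?num_real // ler_sqr ?nnegrE.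
  have s2 : xi.2 ^+ 2 <= M ^+ 2 by rewrite -real_normK ?num_real // ler_sqr ?nnegrE.
  rewrite /B; nra.
have dot0 : 0 <= 1 + dot2 xi xi by rewrite /dot2 -!expr2 !addr_ge0 ?sqr_ge0.
have wB (x : R) : `|x| <= M -> B `^ (- (9 / 8)) <= weight x.
  move=> xM; rewrite /weight !powRN lef_pV2 ?posrE ?powR_gt0 ?ltr_pwDl //.
  by apply: ge0_ler_powR; rewrite ?nnegrE ?addr_ge0 ?lerD2l.
have P2 : ((1 + dot2 xi xi) `^ (3 / 8 / 2)) ^+ 2 <= 2 * B `^ (3 / 4).
  rewrite -powR_mulrn ?powR_ge0 // -powRrM (_ : 3 / 8 / 2 * 2 = 3 / 8); last by field.
  apply: le_trans (_ : (2 * B `^ 2) `^ (3 / 8) <= _).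
    by apply: ge0_ler_powR; rewrite ?nnegrE ?mulr_ge0 ?powR_ge0.
  rewrite powRM ?powR_ge0 // -powRrM (_ : 2 * (3 / 8) = 3 / 4); last by field.
  by rewrite ler_wpM2r ?powR_ge0 // ler1_powR //; lra.
apply: le_trans (_ : 2 * B `^ (3 / 4) * (C / B ^+ 3) <= _).
  apply: le_trans (_ : ((1 + dot2 xi xi) `^ (3 / 8 / 2)) ^+ 2 * (C / B ^+ 3) <= _).
    by apply: ler_wpM2l => //; exact: sqr_ge0.
  by apply: ler_wpM2r P2; rewrite divr_ge0 // exprn_ge0 // ltW.
have -> : 2 * B `^ (3 / 4) * (C / B ^+ 3) = 2 * C * (B `^ (- (9 / 8)) * B `^ (- (9 / 8))).
  have Bn0 : B != 0 by rewrite gt_eqF.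
  rewrite -powRD ?Bn0 ?implybT // (_ : - (9 / 8) + - (9 / 8) = 3 / 4 - 3); last by field.
  rewrite powRB ?Bn0 ?implybT // powR_mulrn ?ltW //; ring.
apply: ler_wpM2l; first by rewrite mulr_ge0.
by apply: ler_pM; rewrite ?powR_ge0 ?wB.
Qed.

Section DiscSobolev.
Variable a : R.
Hypothesis a0 : 0 < a.
Local Open Scope complex_scope.

Let cosneg (x : R) : R := cos (- x).
Let sinneg (x : R) : R := sin (- x).

Lemma continuous_comp_opp (t : R -> R) : continuous t -> continuous (fun x => t (- x)).
Proof.
by move=> ct x; apply: (continuous_comp (f := -%R)); [exact: continuousN|exact: ct].
Qed.

Let ccos : continuous cosneg. Proof. exact: continuous_comp_opp (@continuous_cos R). Qed.
Let csin : continuous sinneg. Proof. exact: continuous_comp_opp (@continuous_sin R). Qed.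
Let cos1 x : `|cosneg x| <= 1. Proof. exact: cos_max. Qed.
Let sin1 x : `|sinneg x| <= 1. Proof. exact: sin_max. Qed.
Let cospi x : cosneg (x + pi) = - cosneg x.
Proof. by rewrite /cosneg !cosN cosDpi. Qed.
Let sinpi x : sinneg (x + pi) = - sinneg x.
Proof. by rewrite /sinneg !sinN sinDpi. Qed.

Definition disc_fourier (xi : R * R) : R[i] :=
  cintegral (lebesgue2 R) (disc a) (fun x => cexpi (- dot2 x xi)).

(** Once the truncation radius exceeds a, truncating changes nothing. *)
Lemma truncated_fourier_disc n xi : a <= n%:R ->
  truncated_fourier (fun x => (\1_(disc a) x : R)%:C) n xi = disc_fourier xi.
Proof.
move=> an.
have sub x : disc a x -> dot2 x x <= n%:R ^+ 2.
  move=> /le_trans; apply; rewrite ler_sqr ?nnegrE // ltW //.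
rewrite /truncated_fourier /disc_fourier /cintegral.
congr (_ +i* _); rewrite Rintegral_mkcond [RHS]Rintegral_mkcond;
  congr Rintegral; apply/funext => x; rewrite !patchE indicE.
  have [xD|xD] := boolP (x \in disc a).
    by rewrite mem_set /=; [rewrite mul1r mul0r subr0|apply: sub; exact: set_mem].
  by case: ifP => // _ /=; rewrite !mul0r subr0.
have [xD|xD] := boolP (x \in disc a).
  by rewrite mem_set /=; [rewrite mul1r mul0r addr0|apply: sub; exact: set_mem].
by case: ifP => // _ /=; rewrite !mul0r addr0.
Qed.

Lemma decay_const_ge0 : 0 <= decay_const a.
Proof.
rewrite /decay_const; apply: addr_ge0; apply: mulr_ge0; rewrite ?ler0n ?exprn_even_ge0 //.
by apply: mulr_ge0; [apply: mulr_ge0; [exact: ler0n|exact: ltW]|exact: exprn_ge0 (pi_ge0 R)].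
Qed.

Lemma integrable_weight2 :
  (lebesgue2 R).-integrable setT (EFin \o (fun xi => 2 * decay_const a * (weight xi.1 * weight xi.2))).
Proof.
exact: (integrableZl measurableT (2 * decay_const a) (integrable_prodT integrable_weight integrable_weight)).
Qed.

Let wt (xi : R * R) : R := (1 + dot2 xi xi) `^ (3 / 8 / 2).

Lemma measurable_wt : measurable_fun setT (wt : RM * RM -> R).
Proof.
apply: (@measurableT_comp _ _ _ _ _ _ (@powR R ^~ (3 / 8 / 2)) _ (fun xi : RM * RM => 1 + dot2 xi xi : RM)) => //.
by apply: measurable_funD => //; exact: measurable_dot2.
Qed.

Lemma wt_ge1 xi : 1 <= wt xi.
Proof.
have {1}-> : 1 = 1 `^ (3 / 8 / 2) :> R by rewrite powR1.
apply: ge0_ler_powR; rewrite ?nnegrE ?lerDl ?addr_ge0 // /dot2 -!expr2 ?addr_ge0 ?sqr_ge0 //.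
Qed.

Lemma weighted_disc_transform_Lfun2 (t : R -> R) : continuous t ->
  (forall x, `|t x| <= 1) -> (forall x, t (x + pi) = - t x) ->
  (fun xi => disc_transform a t xi) \in Lfun (lebesgue2 R) 2%:E /\
  (fun xi => wt xi * disc_transform a t xi) \in Lfun (lebesgue2 R) 2%:E.
Proof.
move=> ct t1 tpi.
have mt := measurable_disc_transform a0 ct t1.
have B xi : (wt xi * disc_transform a t xi) ^+ 2 <= 2 * decay_const a * (weight xi.1 * weight xi.2).
  rewrite exprMn; apply: weight_bound; first exact: decay_const_ge0.
  exact: disc_transform_decay.
split; apply: Lfun2_dominated integrable_weight2 _ => //.
  move=> xi; apply: le_trans (B xi).
  by rewrite exprMn ler_peMl ?sqr_ge0 // exprn_ege1 // wt_ge1.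
by apply: measurable_funM => //; exact: measurable_wt.
Qed.

Lemma sobolev_disc : sobolev (3 / 8) (fun x => (\1_(disc a) x : R)%:C).
Proof.
have [c1 c2] := weighted_disc_transform_Lfun2 ccos cos1 cospi.
have [s1 s2] := weighted_disc_transform_Lfun2 csin sin1 sinpi.
have mD := @measurable_disc R a.
have ID : (lebesgue2 R).-integrable setT (EFin \o (\1_(disc a) : RM * RM -> R)).
  apply: (@integrable_box _ _ a); first exact: measurable_indic.
  move=> p; have := @box_bound _ a a p p 1 (ltW a0).
  by rewrite mulr1 normr1; apply => //; exact/disc_coord_le/ltW.
split.
  split; apply: Lfun2_dominated ID _ => /=.
  - exact: measurable_indic.
  - by move=> x; rewrite indicE; case: (_ \in _); rewrite ?expr1n ?expr0n.
  - exact: measurable_cst.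
  - by move=> x; rewrite expr0n indicE.
exists disc_fourier.
  split; first by split.
  apply: cvg_near_cst; near=> n.
  apply: integral0_eq => xi _; rewrite truncated_fourier_disc.
    by rewrite subrr /ComplexField.Normc.normc /= !expr0n /= addr0 sqrtr0 expr0n.
  by near: n; exact: nbhs_infty_ger.
split.
- rewrite (_ : (fun _ => _) = (fun xi => wt xi * disc_transform a cosneg xi)) //.
  by apply/funext => xi /=; rewrite mul0r subr0.
- rewrite (_ : (fun _ => _) = (fun xi => wt xi * disc_transform a sinneg xi)) //.
  by apply/funext => xi /=; rewrite mul0r addr0.
Unshelve. all: by end_near.
Qed.

End DiscSobolev.

End Weight.

(** * The circular cone is admissible *)

Section Final.
Variable R : realType.

Lemma bounded_disc (a : R) : 0 <= a -> bounded_set (disc a : set (R * R)).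
Proof.
move=> a0; exists a; split; first exact: num_real.
move=> M aM x /(disc_coord_le a0) [x1 x2].
by rewrite /Num.norm /= ge_max !(le_trans _ (ltW aM)).
Qed.

Lemma circular_coneE (rho : R) : 0 < rho -> rho < pi / 2 ->
  circular_cone rho = cone_over (disc (tan rho)).
Proof.
move=> r0 rpi; apply/seteqP; split => x.
  move=> /(circular_coneP _ r0 rpi) [c0 H].
  have [cz|cn0] := eqVneq (x 0 2%:R) 0.
    exists (0, 0), 0; split => //; first by rewrite /disc /dot2 /= !mul0r addr0 sqr_ge0.
    move: H; rewrite cz mulr0 expr0n /= => H.
    have : (x 0 0) ^+ 2 + (x 0 1) ^+ 2 == 0 by rewrite eq_le H addr_ge0 ?sqr_ge0.
    rewrite paddr_eq0 ?sqr_ge0 // !sqrf_eq0 => /andP[/eqP az /eqP bz].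
    by rewrite !mul0r -(vec3_coord x) az bz cz.
  exists (x 0 0 / x 0 2%:R, x 0 1 / x 0 2%:R), (x 0 2%:R); split => //=.
    rewrite /disc /dot2 /= -!expr2; move: (tan rho) H => k H; rewrite !expr_div_n -mulrDl ler_pdivrMr; last first.
      by rewrite exprn_even_gt0.
    by rewrite -exprMn.
  by rewrite !(mulrCA (x 0 2%:R)) divff // !mulr1 vec3_coord.
move=> [[u v] [t [D t0 ->]]]; apply/(circular_coneP _ r0 rpi); rewrite !vec3E /=.
split => //.
move: D; rewrite /disc /dot2 /= -!expr2; move: (tan rho) => k D.
by rewrite !exprMn -mulrDr [X in _ <= X]mulrC ler_wpM2l ?sqr_ge0.
Qed.

Lemma image_mulmx1 (A : set 'rV[R]_3) : [set y *m 1%:M | y in A] = A.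
Proof.
by apply/seteqP; split => [x [y Ay <-]|x Ax]; [rewrite mulmx1|exists x; rewrite ?mulmx1].
Qed.

End Final.

Theorem proposition6p2 (R : realType) (rho : R) (rho_gt0 : 0 < rho)
  (rho_lt : rho < pi / 2) : admissible_medium_cone (circular_cone rho).
Proof.
have k0 := tan_gt0 rho_gt0 rho_lt.
have orth1 : @orthonormal_rows R 1%:M by rewrite /orthonormal_rows trmx1 mulmx1.
split.
  split; first exact: circular_cone_closed.
    apply/(circular_coneP _ rho_gt0 rho_lt); rewrite !mxE !mulr0 expr0n addr0.
    by split.
  by move=> t x; exact: circular_coneZ.
split.
- by exists rho, 1%:M; split; rewrite ?rho_gt0 ?image_mulmx1.
- exact: circular_cone_exterior_connected.
- exists 1%:M, (disc (tan rho)); split => //.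
  + by rewrite image_mulmx1 circular_coneE.
  + exact: bounded_disc (ltW k0).
  + exists (3 / 8); last exact: sobolev_disc.
    by apply/andP; split; lra.
- exact: circular_cone_detects.
Qed.
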